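(* Let $D$ be a $\mathrm{C}^*$-algebra, let $C$ be a $\mathrm{C}^*$-subalgebra of $D$ with a common unit, and let $E_C^D : D \to C$ be a conditional expectation of finite index. Then there exists a constant $\gamma > 0$ such that the following holds: for any $A, B \in \mathrm{IMS}(C,D,E_C^D)$, if $d(A,B) < \gamma$, then there exists a unitary $u \in C^*(A,B)$ such that $uAu^* = B$. Moreover, the unitary $u$ can be chosen in the relative commutant $C' \cap D$.
   Context: For $\mathrm{C}^*$-subalgebras $A, B$ of a $\mathrm{C}^*$-algebra, with unit balls $A_1, B_1$, the distance $d(A,B)$ is the Hausdorff distance between unit balls: $d(A,B) = \max\{\sup_{a\in A_1}\inf_{b\in B_1}\|a-b\|,\ \sup_{b\in B_1}\inf_{a\in A_1}\|b-a\|\}$. ''With a common unit'' means that $D$ is unital and the unit of $D$ belongs to $C$. A conditional expectation $E : D \to C$ (onto $C$) is of finite index if there is a finite set $\{u_1,\dots,u_N\} \subset D$, called a basis (or quasi-basis) for $E$, such that $x = \sum_{i=1}^N u_i E(u_i^* x)$ for all $x \in D$. $\mathrm{IMS}(C,D,E_C^D)$ denotes the set of all intermediate $\mathrm{C}^*$-subalgebras $A$, $C \subset A \subset D$, for which there is a conditional expectation $E_A^D : D \to A$ satisfying the compatibility condition $E_C^A \circ E_A^D = E_C^D$, where $E_C^A := E_C^D|_A : A \to C$. $C^*(A,B)$ denotes the $\mathrm{C}^*$-subalgebra of $D$ generated by $A$ and $B$, and $C' \cap D = \{x \in D : xc = cx \text{ for all } c \in C\}$. *)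

(* Defs.v *)
From HB Require Import structures.
From mathcomp Require Import all_boot all_order all_algebra.
From mathcomp Require Import all_classical all_reals all_analysis.
From mathcomp Require Export complex.

Set Implicit Arguments.
Unset Strict Implicit.
Unset Printing Implicit Defensive.

Import Order.TTheory GRing.Theory Num.Theory.
Import numFieldNormedType.Exports.

Local Open Scope classical_set_scope.
Local Open Scope complex_scope.
Local Open Scope ring_scope.

(* Unital C*-algebras over the complex numbers R[i].  MathComp has no common
   ancestor of rings and normed modules below [numDomainType], so HB cannot
   join the two: the multiplication is a field of the mixin, and the ring
   structure is declared afterwards on the carrier of every [cstarAlgType].
   The zero C*-algebra is not excluded, hence a [pzRingType]. *)
HB.mixin Record isCStarAlgebra (R : realType) D
    of CompleteNormedModule R[i] D := {
  cstar_one : D ;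
  cstar_mul : D -> D -> D ;
  adj : D -> D ;
  cstar_mulA : associative cstar_mul ;
  cstar_mul1 : left_id cstar_one cstar_mul ;
  cstar_mulr1 : right_id cstar_one cstar_mul ;
  cstar_mulDl : left_distributive cstar_mul +%R ;
  cstar_mulDr : right_distributive cstar_mul +%R ;
  cstar_scaleAl : forall (a : R[i]) (x y : D),
    a *: cstar_mul x y = cstar_mul (a *: x) y ;
  cstar_scaleAr : forall (a : R[i]) (x y : D),
    a *: cstar_mul x y = cstar_mul x (a *: y) ;
  cstar_normM : forall x y : D, `|cstar_mul x y| <= `|x| * `|y| ;
  adjK : involutive adj ;
  adjD : forall x y : D, adj (x + y) = adj x + adj y ;
  adjZ : forall (a : R[i]) (x : D), adj (a *: x) = a^*%C *: adj x ;
  adj_mul : forall x y : D, adj (cstar_mul x y) = cstar_mul (adj y) (adj x) ;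
  cstar_norm_adj_mul : forall x : D, `|cstar_mul (adj x) x| = `|x| ^+ 2
}.

#[short(type="cstarAlgType")]
HB.structure Definition CStarAlgebra (R : realType) :=
  {D of CompleteNormedModule R[i] D & isCStarAlgebra R D}.

HB.instance Definition _ (R : realType) (D : cstarAlgType R) :=
  GRing.Zmodule_isPzRing.Build (CStarAlgebra.sort D)
    (@cstar_mulA R D) (@cstar_mul1 R D) (@cstar_mulr1 R D)
    (@cstar_mulDl R D) (@cstar_mulDr R D).

Section CStarAlgebraRing.
Context {R : realType} {D : cstarAlgType R}.
Implicit Types x y : D.

Lemma cstar_scalerAl (a : R[i]) x y : a *: (x * y) = (a *: x) * y.
Proof. exact: cstar_scaleAl. Qed.

Lemma cstar_scalerAr (a : R[i]) x y : a *: (x * y) = x * (a *: y).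
Proof. exact: cstar_scaleAr. Qed.

Lemma cstar_ler_normM x y : `|x * y| <= `|x| * `|y|.
Proof. exact: cstar_normM. Qed.

Lemma adjM x y : adj (x * y) = adj y * adj x.
Proof. exact: adj_mul. Qed.

Lemma cstar_identity x : `|adj x * x| = `|x| ^+ 2.
Proof. exact: cstar_norm_adj_mul. Qed.

End CStarAlgebraRing.

Section CStarAlgebraDefs.
Context {R : realType} {D : cstarAlgType R}.
Implicit Types (A B C : set D) (E : D -> D).

Record cstar_subalgebra A : Prop := {
  cstar_sub0 : A 0 ;
  cstar_subD : forall x y, A x -> A y -> A (x + y) ;
  cstar_subZ : forall (a : R[i]) x, A x -> A (a *: x) ;
  cstar_subM : forall x y, A x -> A y -> A (x * y) ;
  cstar_sub_adj : forall x, A x -> A (adj x) ;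
  cstar_sub_closed : closed A
}.

Definition cstar_generated A B : set D :=
  smallest cstar_subalgebra (A `|` B).

Definition unit_ball A : set D := [set a | A a /\ `|a| <= 1].

(* The norm of D takes values in R[i]; its values are nonnegative reals, so
   the real part loses nothing. *)
Definition rnorm (x : D) : R := complex.Re `|x|.

(* sup_{a in A_1} inf_{b in B_1} ||a - b|| *)
Definition excess A B : \bar R :=
  ereal_sup [set ereal_inf [set (rnorm (a - b))%:E | b in unit_ball B]
            | a in unit_ball A].

Definition cstar_dist A B : \bar R := Order.max (excess A B) (excess B A).

(* The positive elements of the C*-subalgebra A. *)
Definition positive_in A : set D := [set adj y * y | y in A].

(* A map D -> A is represented by a map E : D -> D with values in A. *)
Record conditional_expectation A E : Prop := {
  cond_exp_linear : linear E ;
  cond_exp_in : forall x, A (E x) ;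
  cond_exp_id : forall a, A a -> E a = a ;
  cond_exp_Ml : forall a x, A a -> E (a * x) = a * E x ;
  cond_exp_Mr : forall a x, A a -> E (x * a) = E x * a ;
  cond_exp_positive : forall x, positive_in setT x -> positive_in A (E x)
}.

Definition finite_index E : Prop :=
  exists (N : nat) (u : 'I_N -> D),
    forall x, x = \sum_(i < N) u i * E (adj (u i) * x).

(* E_C^A is the restriction of E_C^D to A, so E_C^A \o E_A^D is E \o EA. *)
Definition IMS C E : set (set D) :=
  [set A | [/\ cstar_subalgebra A, C `<=` A &
     exists2 EA : D -> D, conditional_expectation A EA &
       forall x, E (EA x) = E x]].

Definition unitary (u : D) : Prop := adj u * u = 1 /\ u * adj u = 1.

Definition relative_commutant C : set D :=
  [set x | forall c, C c -> x * c = c * x].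

End CStarAlgebraDefs.

(* Main.v *)
Require Import Defs.
From HB Require Import structures.
From mathcomp Require Import all_boot all_order all_algebra.
From mathcomp Require Import all_classical all_reals all_analysis.
From mathcomp Require Import ring lra.

(** Let A and B be close intermediate subalgebras with compatible expectations
    EA and EB. A quasi-basis u_i of E gives the quasi-basis a_i = EA(u_i) of
    the restriction of E to A ([expectation_quasi_basis]), and sum_i a_i (x)
    a_i* commutes with A ([casimir]). The index h = sum_i a_i a_i* is
    invertible, with bounds that depend on the u_i only
    ([index_element_inverse]); this uniformity is what makes the constant gamma
    independent of A and B. Hence the average

      T(x) = h^-1 sum_i a_i EB(a_i* x)

    is a left A-linear and right B-linear operator on D, and it is close to EB
    because A is close to B ([averaged_near]).

    Being close to the idempotent EB, the operator T has an idempotent near it,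
    whose range W is an A-B-bimodule close to B. This forces W = v B for an
    element v of W close to 1 ([near_projection_intertwiner]). As W is a left
    A-module, A v is contained in v B, so v^-1 A v is contained in B; this is
    an equality because the two algebras are close ([subspace_eq_of_near]). The
    unitary comes from the polar decomposition of v ([unitary_of_similarity]).
    Since T preserves the C*-subalgebra of those elements of C*(A, B) that
    commute with C, this subalgebra contains v, and with v the unitary.

    Three facts on C*-algebras are needed: conditional expectations are
    contractive, elements close to 1 have inverses and square roots, and the
    index is bounded below. They are obtained without spectral theory. Square
    roots are fixed points of a contraction ([operator_sqrt]); positivity is
    defined by a norm inequality, and its calculus rests on the fact that the
    real part of a unitary has norm at most 1 ([rnorm_le1_of_sqrD]); the
    positivity of x* x is [nonneg_adjM]. *)

Set Implicit Arguments.
Unset Strict Implicit.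
Unset Printing Implicit Defensive.

Import Order.TTheory GRing.Theory Num.Theory.
Import numFieldNormedType.Exports.

Local Open Scope classical_set_scope.
Local Open Scope complex_scope.
Local Open Scope ring_scope.

(** * The real-valued norm *)

Section RealNorm.
Context {R : realType} {D : cstarAlgType R}.
Implicit Types (x y z : D) (r : R) (F : set D).

Lemma normr_rnorm x : `|x| = (rnorm x)%:C.
Proof.
have := normr_ge0 x; rewrite /rnorm lecE /=.
by case: `|x| => a b /= /andP[/eqP ->].
Qed.

Lemma rnorm_ge0 x : 0 <= rnorm x.
Proof. by have := normr_ge0 x; rewrite normr_rnorm lecR. Qed.

Lemma rnorm0 : rnorm (0 : D) = 0.
Proof. by rewrite /rnorm normr0. Qed.

Lemma rnormN x : rnorm (- x) = rnorm x.
Proof. by rewrite /rnorm normrN. Qed.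

Lemma rnormD x y : rnorm (x + y) <= rnorm x + rnorm y.
Proof. by have := ler_normD x y; rewrite !normr_rnorm -rmorphD lecR. Qed.

Lemma rnormB x y : rnorm (x - y) <= rnorm x + rnorm y.
Proof. by rewrite -(rnormN y); exact: rnormD. Qed.

Lemma rdistC x y : rnorm (x - y) = rnorm (y - x).
Proof. by rewrite -rnormN opprB. Qed.

Lemma rdist_trans y x z : rnorm (x - z) <= rnorm (x - y) + rnorm (y - z).
Proof. by apply: le_trans (rnormD _ _); rewrite addrA subrK. Qed.

Lemma rnorm_sum (I : finType) (f : I -> D) :
  rnorm (\sum_i f i) <= \sum_i rnorm (f i).
Proof.
elim/big_ind2: _ => [|x1 r1 x2 r2 h1 h2|//]; first by rewrite rnorm0.
by apply: le_trans (rnormD _ _) _; exact: lerD.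
Qed.

Lemma rnormZc (a : R[i]) x : rnorm (a *: x) = complex.Re `|a| * rnorm x.
Proof.
by have := normrZ a x; rewrite !normr_rnorm normc_def -rmorphM => -[].
Qed.

Lemma rnormZ r x : rnorm (r%:C *: x) = `|r| * rnorm x.
Proof.
by rewrite rnormZc normc_def /= expr0n addr0 sqrtr_sqr.
Qed.

Lemma rnormM x y : rnorm (x * y) <= rnorm x * rnorm y.
Proof. by have := cstar_ler_normM x y; rewrite !normr_rnorm -rmorphM lecR. Qed.

Lemma rnormM_le x y (r s : R) : rnorm x <= r -> rnorm y <= s ->
  rnorm (x * y) <= r * s.
Proof.
move=> xr ys; apply: le_trans (rnormM _ _) _.
by apply: ler_pM; rewrite ?rnorm_ge0.
Qed.

Lemma rnorm_adjM x : rnorm (adj x * x) = rnorm x ^+ 2.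
Proof. by have := cstar_identity x; rewrite !normr_rnorm -rmorphXn => -[]. Qed.

Lemma rnorm_eq0 x : rnorm x = 0 -> x = 0.
Proof. by move=> x0; apply/normr0_eq0; rewrite normr_rnorm x0. Qed.

Lemma eq_of_rdist_le x y : (forall e, 0 < e -> rnorm (x - y) <= e) -> x = y.
Proof.
move=> h; apply/subr0_eq/rnorm_eq0/le_anti; rewrite rnorm_ge0 andbT.
by apply/ler_addgt0Pr => e e0; rewrite add0r h.
Qed.

(** Closedness phrased with real radii: the topology of the algebra is indexed
    by complex ones, and this form is what all limit arguments below use. *)
Definition approx_closed F :=
  forall x, (forall e, 0 < e -> exists2 y, F y & rnorm (x - y) < e) -> F x.

Lemma closed_approx F : closed F <-> approx_closed F.
Proof.
split=> [cF x Fx|Fc].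
  apply: cF => B /nbhs_ballP[[e i] /=]; rewrite ltcE /= => /andP[/eqP -> e0] xB.
  have [y Fy xy] := Fx e e0; exists y; split=> //; apply: xB.
  by rewrite -ball_normE /= normr_rnorm ltcR.
move=> x clFx; apply: Fc => e e0.
have [|y [Fy]] := clFx (ball x e%:C).
  by apply/nbhs_ballP; exists e%:C => //=; rewrite ltcR.
by rewrite -ball_normE /= normr_rnorm ltcR => xy; exists y.
Qed.

Lemma geometric_small (K q e : R) : 0 <= q < 1 -> 0 < e ->
  exists n, K * q ^+ n < e.
Proof.
move=> /andP[q0 q1] e0.
have q1' : `|q| < 1 by rewrite ger0_norm.
have /cvgrPdist_lt/(_ e e0) [n _ /(_ n (leqnn n))] /= := cvg_geometric K q1'.
by rewrite sub0r normrN => h; exists n; apply: le_lt_trans h; exact: ler_norm.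
Qed.

Lemma geometric_cauchy_cvg (u : nat -> D) (K q : R) : 0 <= K -> 0 <= q < 1 ->
    (forall n, rnorm (u n.+1 - u n) <= K * q ^+ n) ->
  exists l, forall n, rnorm (l - u n) <= K / (1 - q) * q ^+ n.
Proof.
move=> K0 q01 uq; have /andP[q0 q1] := q01.
have p0 : 0 < 1 - q by rewrite subr_gt0.
have tail n k : rnorm (u (n + k)%N - u n) <= K / (1 - q) * q ^+ n.
  suff: rnorm (u (n + k)%N - u n) <= K / (1 - q) * q ^+ n * (1 - q ^+ k).
    move/le_trans; apply; apply: ler_piMr; last by rewrite gerBl exprn_ge0.
    by rewrite mulr_ge0 ?exprn_ge0// divr_ge0// ltW.
  elim: k => [|k ih]; first by rewrite addn0 subrr rnorm0 expr0 subrr mulr0.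
  rewrite addnS; apply: le_trans (rdist_trans (u (n + k)%N) _ _) _.
  apply: le_trans (lerD (uq _) ih) _.
  rewrite exprD exprS le_eqVlt; apply/orP; left; apply/eqP.
  by field; rewrite gt_eqF.
have cu : cvg (u @ \oo).
  apply/cauchy_cvgP/cauchyP => eps; rewrite ltcE /= => /andP[/eqP eE e0].
  have [n nE] := geometric_small (K / (1 - q)) q01 e0.
  exists (u n); exists n => // m /= nm.
  rewrite -ball_normE /= normr_rnorm.
  rewrite (_ : eps = (complex.Re eps)%:C); last first.
    by case: eps eE {e0 nE} => a b /= ->.
  by rewrite ltcR rdistC -(subnKC nm); apply: le_lt_trans nE.
exists (lim (u @ \oo)) => n; apply/ler_addgt0Pr => e e0.
have /cvgrPdist_lt/(_ e%:C) := cu; rewrite ltcR => /(_ e0) [m _ mE].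
have := mE (n + m)%N (leq_addl _ _); rewrite /= normr_rnorm ltcR => /ltW h.
apply: le_trans (rdist_trans (u (n + m)%N) _ _) _.
by rewrite addrC lerD.
Qed.

End RealNorm.

(** * Linear identities *)

Section SquareZeroExtension.
Context {K : comNzRingType} {V : lmodType K}.

(** The commutative ring K + V in which the product of two vectors is zero. It
    turns an identity between linear combinations of vectors into an identity
    in a commutative ring, where the tactic [ring] applies. *)
Definition square_zero : Type := (K * V)%type.

HB.instance Definition _ := GRing.Zmodule.on square_zero.

Definition sqz_mul (p q : square_zero) : square_zero :=
  (p.1 * q.1, p.1 *: q.2 + q.1 *: p.2).

Lemma sqz_mulA : associative sqz_mul.
Proof.
move=> [a x] [b y] [c z]; congr pair => /=; first by rewrite mulrA.
by rewrite !scalerDr !scalerA addrA [c * a]mulrC [c * b]mulrC.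
Qed.

Lemma sqz_mulC : commutative sqz_mul.
Proof. by move=> [a x] [b y]; congr pair => /=; rewrite 1?mulrC 1?addrC. Qed.

Lemma sqz_mul1 : left_id (1, 0) sqz_mul.
Proof. by move=> [a x]; rewrite /sqz_mul /= mul1r scale1r scaler0 addr0. Qed.

Lemma sqz_mulDl : left_distributive sqz_mul +%R.
Proof.
move=> [a x] [b y] [c z]; congr pair => /=; first by rewrite mulrDl.
by rewrite scalerDl scalerDr addrACA.
Qed.

Lemma sqz_one_neq0 : (1, 0) != 0 :> square_zero.
Proof. by apply/eqP => -[/eqP]; rewrite oner_eq0. Qed.

HB.instance Definition _ := GRing.Zmodule_isComNzRing.Build square_zero
  sqz_mulA sqz_mulC sqz_mul1 sqz_mulDl sqz_one_neq0.

Definition sqz_scalar (a : K) : square_zero := (a, 0).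
Definition sqz_vector (x : V) : square_zero := (0, x).

Lemma sqz_scalar_is_zmod_morphism : zmod_morphism sqz_scalar.
Proof. by move=> a b; congr pair; rewrite /= subr0. Qed.

Lemma sqz_scalar_is_monoid_morphism : monoid_morphism sqz_scalar.
Proof. by split=> // a b; congr pair; rewrite /= !scaler0 addr0. Qed.

HB.instance Definition _ := GRing.isZmodMorphism.Build K square_zero
  sqz_scalar sqz_scalar_is_zmod_morphism.
HB.instance Definition _ := GRing.isMonoidMorphism.Build K square_zero
  sqz_scalar sqz_scalar_is_monoid_morphism.

Lemma sqz_vectorD x y : sqz_vector (x + y) = sqz_vector x + sqz_vector y.
Proof. by congr pair; rewrite /= addr0. Qed.

Lemma sqz_vectorN x : sqz_vector (- x) = - sqz_vector x.
Proof. by congr pair; rewrite /= oppr0. Qed.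

Lemma sqz_vector0 : sqz_vector 0 = 0.
Proof. by []. Qed.

Lemma sqz_vectorMn x n : sqz_vector (x *+ n) = sqz_vector x *+ n.
Proof. by elim: n => // n ih; rewrite !mulrS sqz_vectorD ih. Qed.

Lemma sqz_vectorZ a x : sqz_vector (a *: x) = sqz_scalar a * sqz_vector x.
Proof. by congr pair; rewrite /= ?mulr0 // scale0r addr0. Qed.

Lemma sqz_vector_inj : injective sqz_vector.
Proof. by move=> x y []. Qed.

Definition sqz_vectorE :=
  (sqz_vectorD, sqz_vectorN, sqz_vectorMn, sqz_vectorZ, sqz_vector0).

End SquareZeroExtension.

Ltac linear_ring := apply: sqz_vector_inj; rewrite !sqz_vectorE; ring.

(** Products of algebra elements do not commute, so they are first multiplied
    out into monomials, treated by [linear_ring] as independent vectors. *)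
Ltac expand :=
  rewrite ?(mulrDl, mulrDr, mulrBl, mulrBr, mulNr, mulrN, mulr0, mul0r,
            mul1r, mulr1, opprK, mulrA, =^~ cstar_scalerAl, =^~ cstar_scalerAr).

(** * Bounded operators *)

Section BoundedOperators.
Context {R : realType} {D : cstarAlgType R}.
Implicit Types (x y z : D) (r : R) (F : set D) (X Y Z : D -> D).

Section LinearMaps.
Variables (X : D -> D) (lX : linear X).

Lemma linmap_packed : exists f : {linear D -> D}, X = f.
Proof.
by exists (HB.pack_for {linear D -> D} X (GRing.isLinear.Build _ _ _ _ X lX)).
Qed.

Lemma linmapD x y : X (x + y) = X x + X y.
Proof. by have [f ->] := linmap_packed; exact: linearD. Qed.

Lemma linmapB x y : X (x - y) = X x - X y.
Proof. by have [f ->] := linmap_packed; exact: linearB. Qed.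

Lemma linmapN x : X (- x) = - X x.
Proof. by have [f ->] := linmap_packed; exact: linearN. Qed.

Lemma linmap0 : X 0 = 0.
Proof. by have [f ->] := linmap_packed; exact: linear0. Qed.

Lemma linmapZ a x : X (a *: x) = a *: X x.
Proof. by have [f ->] := linmap_packed; exact: linearZ. Qed.

Lemma linmap_sum (I : finType) (f : I -> D) : X (\sum_i f i) = \sum_i X (f i).
Proof. by have [g ->] := linmap_packed; exact: linear_sum. Qed.

End LinearMaps.

Definition bounded_by K X := linear X /\ forall x, rnorm (X x) <= K * rnorm x.

Lemma bounded_by_cst0 K : 0 <= K -> bounded_by K (fun=> 0 : D).
Proof.
move=> K0; split=> [a x y|x]; first by rewrite scaler0 addr0.
by rewrite rnorm0 mulr_ge0 ?rnorm_ge0.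
Qed.

Lemma bounded_by_id : bounded_by 1 (id : D -> D).
Proof. by split=> [a x y|x]; rewrite ?mul1r. Qed.

Lemma bounded_by_comp K L X Y : 0 <= K ->
  bounded_by K X -> bounded_by L Y -> bounded_by (K * L) (X \o Y).
Proof.
move=> K0 [lX bX] [lY bY]; split=> [a x y|x] /=; first by rewrite lY lX.
by apply: le_trans (bX _) _; rewrite -mulrA ler_wpM2l.
Qed.

Lemma bounded_by_add K L X Y :
  bounded_by K X -> bounded_by L Y -> bounded_by (K + L) (fun x => X x + Y x).
Proof.
move=> [lX bX] [lY bY]; split=> [a x y|x] /=.
  by rewrite lX lY scalerDr addrACA.
by rewrite mulrDl; apply: le_trans (rnormD _ _) _; exact: lerD.
Qed.

Lemma bounded_by_sub K L X Y :
  bounded_by K X -> bounded_by L Y -> bounded_by (K + L) (fun x => X x - Y x).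
Proof.
move=> [lX bX] [lY bY]; split=> [a x y|x] /=.
  by rewrite lX lY scalerBr opprD addrACA.
by rewrite mulrDl; apply: le_trans (rnormB _ _) _; exact: lerD.
Qed.

Lemma bounded_by_scale K r X : 0 <= r ->
  bounded_by K X -> bounded_by (r * K) (fun x => r%:C *: X x).
Proof.
move=> r0 [lX bX]; split=> [a x y|x] /=.
  by rewrite lX scalerDr !scalerA mulrC.
by rewrite rnormZ ger0_norm// -mulrA ler_wpM2l.
Qed.

Lemma bounded_by_mull x : bounded_by (rnorm x) ( *%R x).
Proof.
by split=> [a y z|y]; [rewrite mulrDr cstar_scalerAr | exact: rnormM].
Qed.

Lemma bounded_by_mulr x : bounded_by (rnorm x) ( *%R^~ x).
Proof.
split=> [a y z|y]; first by rewrite mulrDl cstar_scalerAl.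
by rewrite mulrC; exact: rnormM.
Qed.

Lemma bounded_byW K L X : K <= L -> bounded_by K X -> bounded_by L X.
Proof.
move=> KL [lX bX]; split=> // x; apply: le_trans (bX x) _.
by rewrite ler_wpM2r ?rnorm_ge0.
Qed.

(** Banach's fixed point theorem for operators, the iteration starting at 0.
    Every iterate inherits a property Q that Phi preserves, and so does the
    limit if Q is closed for the operator norm; this is how invariant subspaces
    and commutation relations pass to square roots and inverses. *)
Lemma operator_fixpoint (Phi : (D -> D) -> D -> D) (K q : R) :
    0 <= K -> 0 <= q < 1 ->
    (forall Y, bounded_by K Y -> bounded_by K (Phi Y)) ->
    (forall Y Z e, bounded_by K Y -> bounded_by K Z ->
      (forall x, rnorm (Y x - Z x) <= e * rnorm x) ->
      forall x, rnorm (Phi Y x - Phi Z x) <= q * e * rnorm x) ->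
  exists Y, [/\ bounded_by K Y, forall x, Phi Y x = Y x &
    forall Q : (D -> D) -> Prop, Q (fun=> 0) ->
      (forall Z, bounded_by K Z -> Q Z -> Q (Phi Z)) ->
      (forall Z, (forall e, 0 < e -> exists2 Z', Q Z' /\ bounded_by K Z' &
          forall x, rnorm (Z x - Z' x) <= e * rnorm x) -> Q Z) ->
      Q Y].
Proof.
move=> K0 q01 Phib Phic; have /andP[q0 q1] := q01.
pose Yn n := iter n Phi (fun=> 0).
have Ynb n : bounded_by K (Yn n).
  by elim: n => [|n ih] /=; [exact: bounded_by_cst0 | exact: Phib].
(* The operator norm has no carrier type: the iteration is shown to be Cauchy at
   each vector, with a rate proportional to the norm of the vector. *)
have step n x : rnorm (Yn n.+1 x - Yn n x) <= K * rnorm x * q ^+ n.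
  elim: n x => [|n ih] x.
    by rewrite expr0 mulr1 subr0; exact: (Ynb 1).2.
  have := Phic (Yn n.+1) (Yn n) (K * q ^+ n) (Ynb _) (Ynb _).
  move=> /(_ _ x) /le_trans; apply; first by move=> z; rewrite mulrAC.
  by rewrite le_eqVlt exprS; apply/orP; left; apply/eqP; ring.
have /choice[Y YE] x : exists l, forall n,
    rnorm (l - Yn n x) <= K * rnorm x / (1 - q) * q ^+ n.
  by apply: geometric_cauchy_cvg (step^~ x) => //; rewrite mulr_ge0 ?rnorm_ge0.
have YnY e : 0 < e -> exists n, forall m x, (n <= m)%N ->
    rnorm (Y x - Yn m x) <= e * rnorm x.
  move=> e0; have [n /ltW nE] := geometric_small (K / (1 - q)) q01 e0.
  exists n => m x nm; apply: le_trans (YE x m) _.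
  rewrite (_ : _ * q ^+ m = K / (1 - q) * q ^+ m * rnorm x); last by ring.
  apply: ler_wpM2r; [exact: rnorm_ge0 | apply: le_trans nE].
  apply: ler_wpM2l; first by rewrite divr_ge0// subr_ge0 ltW.
  by apply: ler_wiXn2l => //; exact: ltW.
have Yb : bounded_by K Y.
  split=> [a x y|x]; last first.
    apply/ler_addgt0Pr => e e0.
    have p0 : 0 < rnorm x + 1 by rewrite ltr_wpDl ?rnorm_ge0.
    have [n /(_ n x (leqnn n)) nE] := YnY _ (divr_gt0 e0 p0).
    rewrite -(subrK (Yn n x) (Y x)) addrC; apply: le_trans (rnormD _ _) _.
    apply: lerD; first exact: (Ynb n).2.
    apply: le_trans nE _; rewrite mulrAC ler_pdivrMr// ler_wpM2l ?ltW//.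
    by rewrite ltrDl.
  apply: eq_of_rdist_le => e e0.
  pose S := rnorm (a *: x + y) + (complex.Re `|a| * rnorm x + rnorm y) + 1.
  have ca0 : 0 <= complex.Re `|a|.
    by have := normr_ge0 a; rewrite lecE => /andP[].
  have p0 : 0 < S.
    by rewrite ltr_wpDl ?addr_ge0 ?rnorm_ge0// mulr_ge0 ?rnorm_ge0.
  have [n nE] := YnY _ (divr_gt0 e0 p0).
  have -> : Y (a *: x + y) - (a *: Y x + Y y) = Y (a *: x + y)
      - Yn n (a *: x + y) - (a *: (Y x - Yn n x) + (Y y - Yn n y)).
    rewrite (Ynb n).1 scalerBr [in RHS]addrACA -[in RHS]opprD [in RHS]opprB.
    by rewrite addrA subrK.
  apply: (@le_trans _ _ (e / S * (rnorm (a *: x + y)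
      + (complex.Re `|a| * rnorm x + rnorm y)))).
    rewrite !mulrDr; apply: le_trans (rnormB _ _) _.
    apply: lerD; first exact: nE.
    apply: le_trans (rnormD _ _) _; apply: lerD; last exact: nE.
    by rewrite rnormZc mulrCA ler_wpM2l// nE.
  by rewrite mulrAC ler_pdivrMr// ler_wpM2l ?ltW// ltrDl.
exists Y; split=> // [x|Q Q0 QPhi Qlim].
  apply: eq_of_rdist_le => e e0.
  have p0 : 0 < 2 * (rnorm x + 1) by rewrite mulr_gt0// ltr_wpDl ?rnorm_ge0.
  have d0 := divr_gt0 e0 p0; set d := e / _ in d0.
  have [n nE] := YnY _ d0.
  apply: le_trans (rdist_trans (Yn n.+1 x) _ _) _.
  have h1 := Phic Y (Yn n) d Yb (Ynb n) (nE n ^~ (leqnn n)) x.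
  have h2 := nE n.+1 x (leqnSn n).
  have h3 : q * d * rnorm x <= d * rnorm x.
    by rewrite ler_wpM2r ?rnorm_ge0// ger_pMl// ltW.
  have -> : e = d * rnorm x + d * rnorm x + 2 * d by rewrite /d; field; lra.
  by rewrite [rnorm (Yn _ _ - _)]rdistC; move: h1 h2 h3; rewrite /=; lra.
apply: Qlim => e /YnY[n nE]; exists (Yn n); last by move=> x; exact: nE.
split=> //; elim: n {nE} => [|n ih] //=; exact: QPhi.
Qed.

End BoundedOperators.

(** * Adjoints, inverses and square roots *)

Section Adjoint.
Context {R : realType} {D : cstarAlgType R}.
Implicit Types (x y z : D) (r : R) (F : set D).

Lemma adj_one : adj (1 : D) = 1.
Proof. by rewrite -[LHS]mul1r -{1}(adjK 1) -adjM mul1r adjK. Qed.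

Lemma adj_zero : adj (0 : D) = 0.
Proof. by apply: (addrI (adj 0)); rewrite -adjD !addr0. Qed.

Lemma adjN x : adj (- x) = - adj x.
Proof. by apply/eqP; rewrite -addr_eq0 -adjD addNr adj_zero. Qed.

Lemma adjB x y : adj (x - y) = adj x - adj y.
Proof. by rewrite adjD adjN. Qed.

Lemma adjZr r x : adj (r%:C *: x) = r%:C *: adj x.
Proof. by rewrite Defs.adjZ conjc_real. Qed.

Lemma adj_sum (I : finType) (f : I -> D) :
  adj (\sum_i f i) = \sum_i adj (f i).
Proof. exact: (big_morph _ (fun x y => adjD x y) adj_zero). Qed.

Lemma rnorm_adj x : rnorm (adj x) = rnorm x.
Proof.
suff le y : rnorm y <= rnorm (adj y) by apply/le_anti; rewrite -{2}(adjK x) !le.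
have [->|y0] := eqVneq (rnorm y) 0; first exact: rnorm_ge0.
have yp : 0 < rnorm y by rewrite lt_def y0 rnorm_ge0.
by rewrite -(ler_pM2r yp) -expr2 -rnorm_adjM rnormM.
Qed.

Lemma rnorm1_le : rnorm (1 : D) <= 1.
Proof.
have [->|y0] := eqVneq (rnorm (1 : D)) 0; first exact: ler01.
have yp : 0 < rnorm (1 : D) by rewrite lt_def y0 rnorm_ge0.
by rewrite -(ler_pM2r yp) mul1r -expr2 -rnorm_adjM adj_one mul1r.
Qed.

Lemma rnorm_sa_sqr x : adj x = x -> rnorm (x * x) = rnorm x ^+ 2.
Proof. by move=> sx; rewrite -rnorm_adjM sx. Qed.

Lemma approx_closed_sa : approx_closed [set x : D | adj x = x].
Proof.
move=> x h /=; apply: eq_of_rdist_le => e e0.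
have [|y /= sy] := h (e / 2); first by rewrite divr_gt0.
move=> xy; apply: le_trans (rdist_trans y _ _) _.
rewrite -{1}sy -adjB rnorm_adj [rnorm (y - _)]rdistC; lra.
Qed.

Lemma approx_closed_comm b : approx_closed [set x : D | x * b = b * x].
Proof.
move=> x h /=; apply: eq_of_rdist_le => e e0.
have p0 : 0 < 2 * (rnorm b + 1) by rewrite mulr_gt0// ltr_wpDl ?rnorm_ge0.
have d0 := divr_gt0 e0 p0; set d := e / _ in d0.
have [y /= yb xy] := h d d0.
have -> : x * b - b * x = (x - y) * b - b * (x - y).
  by rewrite mulrBl mulrBr yb opprB addrA subrK.
apply: le_trans (rnormB _ _) _.
apply: le_trans (lerD (rnormM _ _) (rnormM _ _)) _.
have -> : e = d * (rnorm b + 1) + (rnorm b + 1) * d.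
  by rewrite /d; field; rewrite gt_eqF// ltr_wpDl ?rnorm_ge0.
have b0 := rnorm_ge0 b; have c0 := rnorm_ge0 (x - y).
by apply: lerD; apply: ler_pM => //; rewrite ?ltW// ltr_pwDr.
Qed.

Lemma approx_closedI F (G : set D) :
  approx_closed F -> approx_closed G -> approx_closed (F `&` G).
Proof.
move=> cF cG x h; split; [apply: cF | apply: cG] => e /h[y [Fy Gy] xy];
  by exists y.
Qed.

End Adjoint.

Section SquareRoots.
Context {R : realType} {D : cstarAlgType R}.
Implicit Types (x y z : D) (r : R) (F : set D) (X Y Z : D -> D).

(** Real, not complex, subspaces: the self-adjoint elements are one of them. *)
Record closed_subspace F : Prop := {
  closed_subspace0 : F 0 ;
  closed_subspaceD : forall x y, F x -> F y -> F (x + y) ;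
  closed_subspaceZ : forall r x, F x -> F (r%:C *: x) ;
  closed_subspace_lim : approx_closed F
}.

Lemma closed_subspaceB F x y : closed_subspace F -> F x -> F y -> F (x - y).
Proof.
move=> cF Fx Fy; apply: (closed_subspaceD cF) => //.
by have := closed_subspaceZ cF (-1) Fy; rewrite rmorphN1 scaleN1r.
Qed.

Lemma cstar_closed_subspace F : cstar_subalgebra F -> closed_subspace F.
Proof.
by case=> S0 SD SZ SM Sadj /closed_approx cS; split=> // r x; exact: SZ.
Qed.

Lemma limit_invariant F Z : approx_closed F ->
  (forall e, 0 < e -> exists2 Z', forall x, F x -> F (Z' x) &
     forall x, rnorm (Z x - Z' x) <= e * rnorm x) ->
  forall x, F x -> F (Z x).
Proof.
move=> cF h x Fx; apply: cF => e e0.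
have p0 : 0 < rnorm x + 1 by rewrite ltr_wpDl ?rnorm_ge0.
have [Z' FZ /(_ x) nE] := h _ (divr_gt0 e0 p0).
exists (Z' x); first exact: FZ.
apply: le_lt_trans nE _; rewrite mulrAC ltr_pdivrMr// ltr_pM2l//.
by rewrite ltrDl.
Qed.

Lemma limit_commute K X Z : 0 <= K -> bounded_by K X ->
  (forall e, 0 < e -> exists2 Z', forall x, X (Z' x) = Z' (X x) &
     forall x, rnorm (Z x - Z' x) <= e * rnorm x) ->
  forall x, X (Z x) = Z (X x).
Proof.
move=> K0 [lX bX] h x; apply: eq_of_rdist_le => e e0.
have p0 : 0 < 2 * K * rnorm x + 1 by rewrite ltr_wpDl// !mulr_ge0 ?rnorm_ge0.
have d0 := divr_gt0 e0 p0; set d := e / _ in d0.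
have [Z' XZ nE] := h _ d0.
have -> : X (Z x) - Z (X x) = X (Z x - Z' x) - (Z (X x) - Z' (X x)).
  by rewrite linmapB// XZ opprB addrA subrK.
apply: le_trans (rnormB _ _) _.
have h1 := le_trans (bX (Z x - Z' x)) (ler_wpM2l K0 (nE x)).
have h2 := le_trans (nE (X x)) (ler_wpM2l (ltW d0) (bX x)).
apply: le_trans (lerD h1 h2) _.
have -> : e = d * (2 * K * rnorm x + 1) by rewrite /d divfK// gt_eqF.
by rewrite mulrDr mulr1; move: (ltW d0); lra.
Qed.

(** The operator 1 - Y is a square root of 1 - X exactly when Y is a fixed
    point of Y |-> (X + Y^2) / 2, and this map contracts the ball of radius r
    with ratio r. *)
Lemma operator_sqrt X r : 0 <= r < 1 -> bounded_by r X ->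
  exists Y, [/\ bounded_by r Y, forall x, Y x + Y x = X x + Y (Y x),
    forall F, closed_subspace F -> (forall x, F x -> F (X x)) ->
      forall x, F x -> F (Y x) &
    forall K Z, 0 <= K -> bounded_by K Z -> (forall x, Z (X x) = X (Z x)) ->
      forall x, Z (Y x) = Y (Z x)].
Proof.
move=> r01 bX; have /andP[r0 r1] := r01; pose h : R := 2^-1.
pose Phi Y x : D := h%:C *: (X x + Y (Y x)).
have h0 : 0 <= h by rewrite invr_ge0.
have [||Y [bY fY Yind]] := operator_fixpoint (Phi := Phi) r0 r01.
- move=> Y bY; apply: bounded_byW (bounded_by_scale h0
    (bounded_by_add bX (bounded_by_comp r0 bY bY))).
  by rewrite /h; nra.
- move=> Y Z e bY bZ YZ x; rewrite /Phi -scalerBr rnormZ ger0_norm//.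
  rewrite opprD addrACA subrr add0r.
  apply: le_trans (ler_wpM2l h0 (rdist_trans (Y (Z x)) _ _)) _.
  rewrite -linmapB; last exact: bY.1.
  have h1 := le_trans (bY.2 (Y x - Z x)) (ler_wpM2l r0 (YZ x)).
  have [/eqP xn0|xn0] := boolP (rnorm x == 0).
    have -> : x = 0 by exact: rnorm_eq0.
    by rewrite !(linmap0 bY.1, linmap0 bZ.1, subrr, rnorm0, addr0, mulr0).
  have e0 : 0 <= e.
    have xp : 0 < rnorm x by rewrite lt_def xn0 rnorm_ge0.
    by rewrite -(pmulr_lge0 _ xp); exact: le_trans (rnorm_ge0 _) (YZ x).
  have h2 := le_trans (YZ (Z x)) (ler_wpM2l e0 (bZ.2 x)).
  apply: le_trans (ler_wpM2l h0 (lerD h1 h2)) _.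
  by rewrite le_eqVlt; apply/orP; left; apply/eqP; rewrite /h; field.
exists Y; split=> // [x|F cF FX x|K Z K0 bZ ZX].
- have hh : h + h = 1 by rewrite /h; field.
  by rewrite -{1 2}fY /Phi -scalerDl -rmorphD hh rmorph1 scale1r.
- move: x; apply: (Yind (fun Y => forall x, F x -> F (Y x))).
  + by move=> x _; exact: closed_subspace0.
  + move=> Z _ FZ x Fx; apply: closed_subspaceZ => //.
    by apply: closed_subspaceD => //; [exact: FX | exact: FZ (FZ _ Fx)].
  + move=> Z hZ; apply: limit_invariant (closed_subspace_lim cF) _ => e.
    by move=> /hZ[Z' [FZ' _] ZZ']; exists Z'.
- apply: (Yind (fun Y => forall x, Z (Y x) = Y (Z x))).
  + by move=> x; rewrite (linmap0 bZ.1).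
  + move=> T _ ZT x; rewrite /Phi (linmapZ bZ.1) (linmapD bZ.1).
    by rewrite ZX !ZT.
  + move=> T hT; apply: limit_commute K0 bZ _ => e.
    by move=> /hT[T' [ZT' _] TT']; exists T'.
Qed.

(** The Neumann series, as the fixed point of Y |-> 1 + (1 - a) Y among
    operators. Its limit commutes with right multiplications, hence is the left
    multiplication by its value at 1. *)
Lemma element_inverse a r : 0 <= r < 1 -> rnorm (1 - a) <= r ->
  exists b, [/\ a * b = 1, b * a = 1, rnorm b <= (1 - r)^-1 &
    forall F, closed_subspace F -> F 1 -> (forall x, F x -> F (a * x)) -> F b].
Proof.
move=> r01 ar; have /andP[r0 r1] := r01.
pose K := (1 - r)^-1; have K0 : 0 <= K by rewrite invr_ge0 subr_ge0 ltW.
pose Phi Y x : D := x + (1 - a) * Y x.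
have bL : bounded_by r ( *%R (1 - a)).
  exact: bounded_byW ar (bounded_by_mull _).
have [||Y [bY fY Yind]] := operator_fixpoint (Phi := Phi) K0 r01.
- move=> Y bY; apply: bounded_byW (bounded_by_add bounded_by_id
    (bounded_by_comp r0 bL bY)).
  by rewrite /K le_eqVlt; apply/orP; left; apply/eqP; field; lra.
- move=> Y Z e bY bZ YZ x; rewrite /Phi opprD addrACA subrr add0r -mulrBr.
  by apply: le_trans (bL.2 _) _; rewrite -mulrA ler_wpM2l.
have aY x : a * Y x = x.
  have := fY x; rewrite /Phi mulrBl mul1r => /eqP.
  by rewrite addrCA -subr_eq0 addrAC subrr add0r subr_eq0 => /eqP.
have Ycomm K' Z : 0 <= K' -> bounded_by K' Z ->
    (forall x, Z (a * x) = a * Z x) -> forall x, Z (Y x) = Y (Z x).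
  move=> K'0 bZ Za; apply: (Yind (fun Y => forall x, Z (Y x) = Y (Z x))).
  + by move=> x; rewrite (linmap0 bZ.1).
  + move=> T _ ZT x; rewrite /Phi (linmapD bZ.1) !mulrBl !mul1r.
    by rewrite (linmapB bZ.1) Za ZT.
  + move=> T hT; apply: limit_commute K'0 bZ _ => e.
    by move=> /hT[T' [ZT' _] TT']; exists T'.
have YR x y : Y x * y = Y (x * y).
  apply: (Ycomm _ ( *%R^~ y) (rnorm_ge0 y)) => [|z]; last by rewrite mulrA.
  exact: bounded_by_mulr.
exists (Y 1); split=> //.
- rewrite YR mul1r; have := Ycomm _ _ (rnorm_ge0 a) (bounded_by_mull a) _ 1.
  by rewrite mulr1 aY => <-.
- apply: le_trans (bY.2 1) _; apply: ler_piMr => //; exact: rnorm1_le.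
move=> F cF F1 Fa.
apply: (Yind (fun Y => forall x, F x -> F (Y x))) F1.
- by move=> x _; exact: closed_subspace0.
- move=> Z _ FZ x Fx; rewrite /Phi mulrBl mul1r.
  apply: (closed_subspaceD cF) => //.
  apply: (closed_subspaceB cF); first exact: FZ.
  by apply: Fa; exact: FZ.
- move=> Z hZ; apply: limit_invariant (closed_subspace_lim cF) _ => e.
  by move=> /hZ[Z' [FZ' _] ZZ']; exists Z'.
Qed.

(** The square root of the operator of left multiplication by a commutes with
    right multiplications, so it is itself a left multiplication. *)
Lemma element_sqrt a r : 0 <= r < 1 -> rnorm (1 - a) <= r ->
  exists s, [/\ s * s = a, rnorm (1 - s) <= r,
    forall F, closed_subspace F -> F 1 -> (forall x, F x -> F (a * x)) -> F s &
    forall b, a * b = b * a -> s * b = b * s].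
Proof.
move=> r01 ar; have /andP[r0 r1] := r01.
have bL : bounded_by r ( *%R (1 - a)).
  exact: bounded_byW ar (bounded_by_mull _).
have [Y [bY fY YF Yc]] := operator_sqrt r01 bL.
have YR x y : Y x * y = Y (x * y).
  apply: (Yc _ ( *%R^~ y) (rnorm_ge0 y)) => [|z]; last by rewrite mulrA.
  exact: bounded_by_mulr.
have YE x : Y x = Y 1 * x by rewrite YR mul1r.
exists (1 - Y 1); split=> [||F cF F1 Fa|b ab].
- have := fY 1; rewrite mulr1 (YE (Y 1)) => E; expand.
  have -> : a = 1 - (Y 1 + Y 1) + Y 1 * Y 1 by rewrite E; linear_ring.
  by linear_ring.
- rewrite opprB addrC subrK; apply: le_trans (bY.2 1) _.
  by apply: ler_piMr => //; exact: rnorm1_le.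
- apply: (closed_subspaceB cF) => //; apply: (YF F cF) F1 => x Fx.
  by rewrite mulrBl mul1r; apply: (closed_subspaceB cF) => //; exact: Fa.
- rewrite mulrBl mulrBr mul1r mulr1; congr (_ - _).
  rewrite -YE -[in LHS](mulr1 b); symmetry.
  apply: (Yc _ _ (rnorm_ge0 b) (bounded_by_mull b)) => x.
  by rewrite mulrBl mulrBr mul1r mulrBl mul1r !mulrA ab.
Qed.

Lemma element_sqrt_sa a r : 0 <= r < 1 -> rnorm (1 - a) <= r -> adj a = a ->
  exists s, [/\ s * s = a, adj s = s, rnorm (1 - s) <= r,
    forall F, closed_subspace F -> F 1 -> (forall x, F x -> F (a * x)) -> F s &
    forall b, a * b = b * a -> s * b = b * s].
Proof.
move=> r01 ar sa; have [s [ss sr sF sc]] := element_sqrt r01 ar.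
exists s; split=> //.
have [] // := sF ([set x | adj x = x] `&` [set x | x * a = a * x]).
- split=> [|x y [/= xs xa] [/= ys ya]|t x [/= xs xa]|].
  + by rewrite /= adj_zero mulr0 mul0r.
  + by rewrite /= adjD xs ys mulrDl mulrDr xa ya.
  + by rewrite /= adjZr xs -cstar_scalerAl -cstar_scalerAr xa.
  + apply: approx_closedI; first exact: approx_closed_sa.
    exact: approx_closed_comm.
- by rewrite /= adj_one mul1r mulr1.
- move=> x [/= xs xa]; split; first by rewrite /= adjM xs sa xa.
  by rewrite /= -mulrA xa.
Qed.

End SquareRoots.

(** * Positive elements *)

Definition real_scalar {R : realType} {D : cstarAlgType R} (r : R) : D :=
  r%:C *: (1 : D).
Notation "r %:D" := (real_scalar r) (at level 2, format "r %:D").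

Ltac expand_scalars := rewrite /real_scalar; expand.

Section Positivity.
Context {R : realType} {D : cstarAlgType R}.
Implicit Types (x y z a b c : D) (r t e : R).

Lemma rnorm_scalar r : rnorm (r%:D : D) <= `|r|.
Proof. by rewrite rnormZ; apply: ler_piMr => //; exact: rnorm1_le. Qed.

Lemma adj_scalar r : adj (r%:D : D) = r%:D.
Proof. by rewrite adjZr adj_one. Qed.

(** Positivity without spectra: a self-adjoint a has its spectrum in [0, 2t] as
    soon as its distance to t is at most t. Sums of positive elements are then
    obviously positive. *)
Definition nonneg a := adj a = a /\ exists2 t, 0 <= t & rnorm (t%:D - a) <= t.

Lemma nonneg_sa a : nonneg a -> adj a = a.
Proof. by case. Qed.

Lemma nonneg_add a b : nonneg a -> nonneg b -> nonneg (a + b).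
Proof.
move=> [sa [t t0 ta]] [sb [u u0 ub]]; split; first by rewrite adjD sa sb.
exists (t + u); first exact: addr_ge0.
have -> : (t + u)%:D - (a + b) = (t%:D - a) + (u%:D - b) :> D.
  by rewrite /real_scalar; linear_ring.
by apply: le_trans (rnormD _ _) _; exact: lerD.
Qed.

Lemma nonneg_scale r a : 0 <= r -> nonneg a -> nonneg (r%:C *: a).
Proof.
move=> r0 [sa [t t0 ta]]; split; first by rewrite adjZr sa.
exists (r * t); first exact: mulr_ge0.
have -> : (r * t)%:D - r%:C *: a = r%:C *: (t%:D - a).
  by rewrite /real_scalar; linear_ring.
by rewrite rnormZ ger0_norm// ler_wpM2l.
Qed.

Lemma nonneg_scalar_sub t a : adj a = a -> rnorm a <= t -> nonneg (t%:D - a).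
Proof.
move=> sa at_; split; first by rewrite adjB adj_scalar sa.
by exists t; [exact: le_trans (rnorm_ge0 a) at_ | rewrite subKr].
Qed.

Lemma nonneg_scalar t : 0 <= t -> nonneg (t%:D : D).
Proof.
move=> t0; rewrite -[t%:D]subr0; apply: nonneg_scalar_sub.
  by rewrite adj_zero.
by rewrite rnorm0.
Qed.

Lemma nonneg_scalar_add t a : adj a = a -> rnorm a <= t -> nonneg (t%:D + a).
Proof.
move=> sa at_; rewrite -[a]opprK; apply: nonneg_scalar_sub.
  by rewrite adjN sa.
by rewrite rnormN.
Qed.

Lemma isometry_rnorm u : adj u * u = 1 :> D -> rnorm u <= 1.
Proof.
move=> u1; rewrite -(@ler_pXn2r _ 2)// ?nnegrE ?rnorm_ge0//.
by rewrite -rnorm_adjM u1 expr1n rnorm1_le.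
Qed.

(** Both b + ic and b - ic are isometries, and b is half their sum. *)
Lemma rnorm_le1_of_sqrD b c : adj b = b -> adj c = c -> b * c = c * b ->
  b * b + c * c = 1 -> rnorm b <= 1.
Proof.
move=> sb sc bc bc1; pose i : R[i] := 'i%C.
have ii : i * i = -1 by rewrite -expr2 sqr_i.
have ci : (i^*)%C = - i by rewrite /i; simpc.
have u1 (k : R[i]) : k * k = -1 -> (k^*)%C = - k -> rnorm (b + k *: c) <= 1.
  move=> kk ck; apply: isometry_rnorm; rewrite adjD Defs.adjZ sb sc ck.
  have -> : 1 = b * b - (k * k) *: (c * c) by rewrite kk scaleN1r opprK.
  by rewrite scaleNr; expand; rewrite -bc; linear_ring.
have h1 := u1 i ii ci.
have h2 : rnorm (b + (- i) *: c) <= 1.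
  by apply: u1; [rewrite mulrNN ii | rewrite -ci conjcK ci opprK].
have h3 := rnormD (b + i *: c) (b + (- i) *: c).
have E : b + i *: c + (b + (- i) *: c) = 2%:C *: b.
  by rewrite scaleNr (natrD _ 1 1) rmorphD rmorph1; linear_ring.
by rewrite E rnormZ ger0_norm// in h3; clear ii ci; lra.
Qed.

(** Adding e moves a, after scaling, strictly inside the unit ball around 1. *)
Lemma nonneg_sqrt a e : 0 < e -> nonneg a ->
  exists p, [/\ p * p = a + e%:D, nonneg p &
    forall b, a * b = b * a -> p * b = b * p].
Proof.
move=> e0 [sa [t t0 ta]]; have te0 : 0 < t + e by rewrite ltr_wpDl.
pose u := Num.sqrt (t + e); have u0 : 0 < u by rewrite sqrtr_gt0.
have uu : u * u = t + e by rewrite -expr2 sqr_sqrtr// ltW.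
pose c : D := (t + e)^-1%:C *: (a + e%:D).
have cE : 1 - c = (t + e)^-1%:C *: (t%:D - a).
  have E : 1 = (t + e)^-1%:C *: (t + e)%:D :> D.
    by rewrite /real_scalar scalerA -rmorphM mulVf ?gt_eqF// rmorph1 scale1r.
  rewrite {1}E /c -scalerBr; congr (_ *: _).
  by rewrite /real_scalar; linear_ring.
have cr : rnorm (1 - c) <= t / (t + e).
  by rewrite cE rnormZ ger0_norm ?invr_ge0 ?(ltW te0)// [t / _]mulrC ler_wpM2l
    ?invr_ge0 ?(ltW te0).
have r1 : 0 <= t / (t + e) < 1.
  by rewrite divr_ge0 ?(ltW te0)//= ltr_pdivrMr// mul1r ltrDl.
have sc : adj c = c by rewrite adjZr adjD adj_scalar sa.
have [s [ss sas sr _ scomm]] := element_sqrt_sa r1 cr sc.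
exists (u%:C *: s); split.
- expand; rewrite scalerA -rmorphM uu ss /c scalerA -rmorphM mulfV ?gt_eqF//.
  by rewrite rmorph1 scale1r.
- apply: nonneg_scale (ltW u0) _; split=> //; exists 1 => //.
  rewrite /real_scalar rmorph1 scale1r; apply: le_trans sr _.
  by case/andP: r1 => _ /ltW.
- move=> b ab; expand; congr (_ *: _); apply: scomm; rewrite /c.
  by expand_scalars; rewrite ab.
Qed.

(** With p^2 = (r + e) - c and q^2 = (r + e) + c one gets c^2 + (pq)^2 = (r +
    e)^2, so the bound on c is that for the real part of a scaled unitary. *)
Lemma rnorm_le_of_nonneg r c : 0 <= r -> adj c = c ->
  nonneg (r%:D - c) -> nonneg (r%:D + c) -> rnorm c <= r.
Proof.
move=> r0 sc nm np; apply/ler_addgt0Pr => e e0.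
have [p [pp /nonneg_sa sp pc]] := nonneg_sqrt e0 nm.
have [q [qq /nonneg_sa sq qc]] := nonneg_sqrt e0 np.
have cp : p * c = c * p by apply: pc; expand_scalars.
have qp : q * p = p * q by apply: qc; expand_scalars; rewrite cp.
have re0 : 0 < r + e by rewrite ltr_wpDl.
pose k := (r + e)^-1; have k0 : 0 <= k by rewrite invr_ge0 ltW.
have ksc (x : D) : adj x = x -> adj (k%:C *: x) = k%:C *: x.
  by move=> sx; rewrite adjZr sx.
have spq : adj (p * q) = p * q by rewrite adjM sp sq.
suff: rnorm (k%:C *: c) <= 1.
  by rewrite rnormZ ger0_norm// mulrC ler_pdivrMr// mul1r.
apply: (rnorm_le1_of_sqrD (ksc _ sc) (ksc _ spq)).
  expand; congr (_ *: (_ *: _)).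
  have cq : q * c = c * q by apply: qc; expand_scalars.
  by rewrite -cp -mulrA -cq mulrA.
have -> : k%:C *: (p * q) * (k%:C *: (p * q)) =
    (k * k)%:C *: ((p * p) * (q * q)).
  by rewrite rmorphM; expand; rewrite -[p * q * p]mulrA qp mulrA scalerA.
have E : (k * k)%:C *: ((r + e) * (r + e))%:D = 1 :> D.
  rewrite /real_scalar scalerA -rmorphM mulrACA /k mulVf ?gt_eqF// mulr1.
  by rewrite rmorph1 scale1r.
by rewrite pp qq -[RHS]E /real_scalar !rmorphM; expand; linear_ring.
Qed.

Lemma rnorm_scalar_sub a t : nonneg a -> rnorm a <= t -> rnorm (t%:D - a) <= t.
Proof.
move=> na at_; have t0 := le_trans (rnorm_ge0 a) at_; have sa := nonneg_sa na.
apply: rnorm_le_of_nonneg => //; first by rewrite adjB adj_scalar sa.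
  by rewrite subKr.
by apply: nonneg_add; [exact: nonneg_scalar | exact: nonneg_scalar_sub].
Qed.

Lemma rnorm_le_of_nonneg_sub a t : 0 <= t ->
  nonneg a -> nonneg (t%:D - a) -> rnorm a <= t.
Proof.
move=> t0 na nta; apply: rnorm_le_of_nonneg (nonneg_sa na) nta _ => //.
by apply: nonneg_add na; exact: nonneg_scalar.
Qed.

Lemma approx_closed_nonneg : approx_closed [set a : D | nonneg a].
Proof.
move=> a h; have sa : adj a = a.
  by apply: approx_closed_sa => e /h[b /= /nonneg_sa sb ab]; exists b.
split=> //; exists (rnorm a + 1); first by rewrite addr_ge0 ?rnorm_ge0.
apply/ler_addgt0Pr => e e0; have p0 : 0 < Num.min 1 (e / 2).
  by rewrite lt_min ltr01 divr_gt0.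
have [b /= nb] := h _ p0; rewrite lt_min => /andP[ab1 abe].
have b1 : rnorm b <= rnorm a + 1.
  rewrite -(subrK a b) addrC; apply: le_trans (rnormD _ _) _.
  by rewrite rdistC lerD2l ltW.
have := rnorm_scalar_sub nb b1.
have := rdist_trans b ((rnorm a + 1)%:D) a.
rewrite [rnorm (b - a)]rdistC; lra.
Qed.

(** After scaling, b^2 + s^2 = 1 for s the square root of 1 - b^2. The bound on
    the real part of a unitary, applied to s, says that 1 - b^2 has norm at
    most 1. *)
Lemma nonneg_sqr b : adj b = b -> nonneg (b * b).
Proof.
move=> sb; split; first by rewrite adjM sb.
have [u u0 bu] : exists2 u, 0 < u & rnorm b < u.
  by exists (rnorm b + 1); rewrite ?ltrDl// ltr_wpDl ?rnorm_ge0.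
exists (u * u); first by rewrite mulr_ge0 ?ltW.
pose c : D := u^-1%:C *: b; have sc : adj c = c by rewrite adjZr sb.
pose r := (rnorm b / u) ^+ 2.
have r01 : 0 <= r < 1.
  rewrite exprn_ge0 ?divr_ge0 ?rnorm_ge0 ?ltW//= expr_lt1//.
    by rewrite ltr_pdivrMr// mul1r.
  by rewrite divr_ge0 ?rnorm_ge0 ?ltW.
have cr : rnorm (1 - (1 - c * c)) <= r.
  by rewrite subKr rnorm_sa_sqr// rnormZ ger0_norm ?invr_ge0 ?(ltW u0)// mulrC.
have scc : adj (1 - c * c) = 1 - c * c by rewrite adjB adj_one adjM sc.
have [s [ss sas _ _ scomm]] := element_sqrt_sa r01 cr scc.
have sc' : s * c = c * s by apply: scomm; expand.
have := rnorm_le1_of_sqrD sas sc sc'; rewrite ss subrK => /(_ erefl) s1.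
have -> : (u * u)%:D - b * b = (u * u)%:C *: (s * s).
  rewrite ss scalerBr; congr (_ - _); rewrite /c; expand.
  rewrite !scalerA -!rmorphM mulrACA mulfV ?gt_eqF// mulr1.
  by rewrite rmorph1 scale1r.
have u2 : 0 <= u * u by rewrite mulr_ge0 ?(ltW u0).
by rewrite rnormZ rnorm_sa_sqr// ger0_norm// ler_piMr// expr_le1 ?rnorm_ge0.
Qed.

(** Up to an error that tends to 0, the product is the square of the product of
    the square roots. *)
Lemma nonneg_mul a b : nonneg a -> nonneg b -> a * b = b * a -> nonneg (a * b).
Proof.
move=> na nb ab; apply: approx_closed_nonneg => e e0.
pose S := rnorm (a + b) + 1; have S0 : 0 < S by rewrite ltr_wpDl ?rnorm_ge0.
pose d := Num.min (1/2) (e / (2 * S)).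
have d0 : 0 < d by rewrite lt_min !divr_gt0// mulr_gt0.
have [p [pp /nonneg_sa sp pc]] := nonneg_sqrt d0 na.
have [q [qq /nonneg_sa sq qc]] := nonneg_sqrt d0 nb.
have pb : p * b = b * p by exact: pc.
have qp : q * p = p * q by exact: qc.
exists ((p * q) * (p * q)).
  by apply: nonneg_sqr; rewrite adjM sp sq.
have -> : a * b - p * q * (p * q) = - (d%:C *: (a + b) + (d * d)%:D).
  rewrite mulrA -[p * q * p]mulrA qp mulrA pp -mulrA qq.
  by rewrite /real_scalar rmorphM; expand; linear_ring.
rewrite rnormN; apply: le_lt_trans (rnormD _ _) _.
apply: le_lt_trans (lerD (lexx _) (rnorm_scalar _)) _.
rewrite rnormZ !ger0_norm ?mulr_ge0 ?ltW//.
have : d * (2 * S) <= e by rewrite -ler_pdivlMr ?mulr_gt0// /d ge_min lexx orbT.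
have : d <= 1/2 by rewrite /d ge_min lexx.
rewrite /S; have := rnorm_ge0 (a + b); nra.
Qed.

Lemma nonneg_sum (I : finType) (f : I -> D) :
  (forall i, nonneg (f i)) -> nonneg (\sum_i f i).
Proof.
move=> nf; elim/big_ind: _ => // [|x y]; last exact: nonneg_add.
by have := nonneg_scalar (lexx 0); rewrite /real_scalar rmorph0 scale0r.
Qed.

End Positivity.

(** * Positivity of x* x *)

Section AdjointSquares.
Context {R : realType} {D : cstarAlgType R}.
Implicit Types (x y z a b c : D) (r t e : R).

(** The sum is 2 (Re x)^2 + 2 (Im x)^2. *)
Lemma nonneg_adjM_add x : nonneg (adj x * x + x * adj x).
Proof.
have h : nonneg ((x + adj x) * (x + adj x)).
  by apply: nonneg_sqr; rewrite adjD adjK addrC.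
have h' : nonneg (('i%C *: (x - adj x)) * ('i%C *: (x - adj x))).
  apply: nonneg_sqr.
  rewrite Defs.adjZ adjB adjK -[in RHS]opprB scalerN -scaleNr.
  by congr (_ *: _); simpc.
have := nonneg_scale (_ : 0 <= 2^-1 :> R) (nonneg_add h h').
rewrite invr_ge0 ler0n => /(_ isT).
have -> // : (x + adj x) * (x + adj x) +
    ('i%C *: (x - adj x)) * ('i%C *: (x - adj x)) =
    2%:C *: (adj x * x + x * adj x) :> D.
  have ii : 'i%C * 'i%C = -1 :> R[i] by rewrite -expr2 sqr_i.
  rewrite -cstar_scalerAl -cstar_scalerAr scalerA ii scaleN1r.
  by rewrite (natrD _ 1 1) rmorphD rmorph1; expand; linear_ring.
by rewrite scalerA -rmorphM mulVf ?pnatr_eq0// rmorph1 scale1r.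
Qed.

(** The case e = 0 shows the idea: put f = - y* y, d = y y* and N = |y|^2, so
    that f and d have norm N and f >= 0. By the previous lemma d >= f >= 0, so
    |N - d| <= N and the norm of y* (N - d) y = - (N f + f^2) is at most N^2.
    But f <= N gives 2 f^2 <= N f + f^2, whence 2 N^2 <= N^2 and N = 0. The
    error e is carried through these estimates. *)
Lemma small_of_adjM_le y e : 0 <= e -> nonneg (e%:D - adj y * y) ->
  rnorm y ^+ 2 <= 3 * e.
Proof.
move=> e0 ny; pose d := adj y * y; pose N := rnorm y ^+ 2.
have N0 : 0 <= N by rewrite exprn_ge0 ?rnorm_ge0.
have sd : adj d = d by rewrite adjM adjK.
have dN : rnorm d = N by exact: rnorm_adjM.
have sd' : adj (y * adj y) = y * adj y by rewrite adjM adjK.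
have nd'e : nonneg (e%:D + y * adj y).
  have := nonneg_add ny (nonneg_adjM_add y).
  by rewrite [adj y * y + _]addrC addrACA addNr addr0.
have d'N : rnorm (y * adj y) = N.
  by rewrite -[y in y * _]adjK rnorm_adjM rnorm_adj.
have h1 : rnorm (N%:D - y * adj y) <= N + e.
  have -> : N%:D - y * adj y = (N + e)%:D - (e%:D + y * adj y) :> D.
    by rewrite /real_scalar; linear_ring.
  apply: rnorm_scalar_sub => //; apply: le_trans (rnormD _ _) _.
  rewrite d'N addrC lerD2l; apply: le_trans (rnorm_scalar _) _.
  by rewrite ger0_norm.
have h2 : rnorm (N%:C *: d - d * d) <= N * (N + e).
  have -> : N%:C *: d - d * d = adj y * (N%:D - y * adj y) * y.
    by rewrite /d; expand_scalars.
  apply: le_trans (rnormM _ _) _.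
  apply: le_trans (ler_wpM2r (rnorm_ge0 y) (rnormM _ _)) _.
  rewrite rnorm_adj mulrAC -expr2; exact: ler_wpM2l.
have h3 : nonneg ((N%:D + d) * (e%:D - d)).
  apply: nonneg_mul => //; first by apply: nonneg_scalar_add; rewrite ?dN.
  by expand_scalars; linear_ring.
have h4 : rnorm (2%:C *: (d * d)) <= N * (N + e) + 2 * e * N.
  have M0 : 0 <= N * (N + e) + 2 * e * N by nra.
  apply: rnorm_le_of_nonneg_sub => //.
    by apply: nonneg_scale => //; exact: nonneg_sqr.
  pose w : D := N%:C *: d - d * d - e%:C *: (N%:D + d).
  have -> : (N * (N + e) + 2 * e * N)%:D - 2%:C *: (d * d) =
     (N%:D + d) * (e%:D - d) + ((N * (N + e) + 2 * e * N)%:D + w).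
    rewrite /w (natrD _ 1 1) [in LHS]rmorphD rmorph1; expand_scalars.
    by linear_ring.
  apply: nonneg_add => //; apply: nonneg_scalar_add.
    by rewrite /w !adjB !adjZr adjD adj_scalar adjM sd.
  apply: le_trans (rnormB _ _) _; apply: lerD => //.
  rewrite rnormZ ger0_norm// [2 * e]mulrC -mulrA ler_wpM2l//.
  apply: le_trans (rnormD _ _) _.
  rewrite dN mulr2n mulrDl mul1r lerD// (le_trans (rnorm_scalar _))//.
  by rewrite ger0_norm.
rewrite rnormZ rnorm_sa_sqr// dN ger0_norm// in h4; rewrite -/N.
have [->|Np] := eqVneq N 0; first by rewrite mulr_ge0.
have N1 : 0 < N by rewrite lt_def Np.
rewrite -(ler_pM2r N1); nra.
Qed.

(** Let a = x* x, let s be the square root of a^2 + e, an approximation of the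
    absolute value of a, and n = s - a, which is about twice the negative part
    of a. With g^2 = 2 n s, the element y = x g satisfies y* y = (e - n^2) s,
    which is at most e |s|. So y is small, hence n^2 s and n are small, and a
    is close to the positive element s. *)
Lemma nonneg_adjM x : nonneg (adj x * x).
Proof.
have sa : adj (adj x * x) = adj x * x by rewrite adjM adjK.
move: {2 3}(adj x * x) (erefl (adj x * x)) sa => a aE; rewrite aE => sa.
apply: approx_closed_nonneg => eta eta0.
(* K is chosen so that the cube of the norm of n ends up below e K. *)
pose K := 9 * (rnorm a + 1) + rnorm a; pose e := Num.min 1 ((eta / 2) ^+ 3 / K).
have K0 : 0 < K by have := rnorm_ge0 a; rewrite /K; lra.
have e0 : 0 < e by rewrite lt_min ltr01 divr_gt0// exprn_gt0// divr_gt0.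
have e1 : e <= 1 by rewrite ge_min lexx.
have eK : e * K <= (eta / 2) ^+ 3 by rewrite -ler_pdivlMr// ge_min lexx orbT.
have [s [ss ns scomm]] := nonneg_sqrt e0 (nonneg_sqr sa).
have sas := nonneg_sa ns.
have sa' : s * a = a * s by apply: scomm; rewrite mulrA.
set S := rnorm s.
have S1 : S <= rnorm a + 1.
  rewrite -(@ler_pXn2r _ 2)// ?nnegrE ?addr_ge0 ?rnorm_ge0// -rnorm_sa_sqr// ss.
  apply: le_trans (rnormD _ _) _; rewrite rnorm_sa_sqr//.
  have := rnorm_scalar (D := D) e; rewrite ger0_norm ?(ltW e0)//.
  have := rnorm_ge0 a; nra.
pose n := s - a; have sn : adj n = n by rewrite adjB sas sa.
have na : n * a = a * n by rewrite /n; expand; rewrite sa'.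
have ns' : n * s = s * n by rewrite /n; expand; rewrite sa'.
have [g [gg /nonneg_sa sg gcomm]] := nonneg_sqrt e0 (nonneg_sqr sn).
have ga : g * a = a * g by apply: gcomm; rewrite -mulrA na mulrA na mulrA.
have nns : 2%:C *: (n * s) = n * n + e%:D.
  rewrite (natrD _ 1 1) rmorphD rmorph1 /n; expand.
  rewrite sa' -[e%:D](addKr (a * a)) -ss.
  by linear_ring.
have ann : 2%:C *: (a * n) = e%:D - n * n.
  rewrite (natrD _ 1 1) rmorphD rmorph1 /n; expand.
  rewrite sa' -[e%:D](addKr (a * a)) -ss.
  by linear_ring.
have yy : adj (x * g) * (x * g) = e%:C *: s - n * n * s.
  rewrite adjM sg -mulrA [adj x * _]mulrA aE mulrA ga -mulrA gg.
  rewrite -nns -cstar_scalerAr.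
  by rewrite mulrA cstar_scalerAl ann; expand_scalars.
have h1 : rnorm (x * g) ^+ 2 <= 3 * (e * S).
  apply: small_of_adjM_le; first by rewrite mulr_ge0 ?rnorm_ge0 ?(ltW e0).
  have -> : (e * S)%:D - adj (x * g) * (x * g) =
      e%:C *: (S%:D - s) + n * n * s.
    by rewrite yy /real_scalar; linear_ring.
  apply: nonneg_add.
    by apply: nonneg_scale (ltW e0) _; exact: nonneg_scalar_sub.
  apply: nonneg_mul => //; first exact: nonneg_sqr.
  by rewrite -mulrA ns' mulrA ns' mulrA.
have h2 : rnorm (n * n * s) <= 4 * (e * S).
  have -> : n * n * s = e%:C *: s - adj (x * g) * (x * g) by rewrite yy subKr.
  apply: le_trans (rnormB _ _) _; rewrite rnorm_adjM.
  rewrite rnormZ (ger0_norm (ltW e0)).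
  by move: h1; rewrite /S; lra.
have nle : rnorm n <= S + rnorm a by exact: rnormB.
have h3 : rnorm (n * n * n) <= e * K.
  have -> : n * n * n = 2%:C *: (n * n * s) - e%:C *: n.
    rewrite -[n * n * s]mulrA cstar_scalerAr nns; expand_scalars.
    by linear_ring.
  apply: le_trans (rnormB _ _) _; rewrite !rnormZ ger0_norm//.
  rewrite (ger0_norm (ltW e0)); have := ler_wpM2l (ltW e0) nle.
  have := ler_wpM2l (ltW e0) S1; rewrite /K; nra.
have h4 : rnorm n ^+ 3 <= rnorm (n * n * n).
  have [->|np] := eqVneq (rnorm n) 0; first by rewrite expr0n rnorm_ge0.
  have n0 : 0 < rnorm n by rewrite lt_def np rnorm_ge0.
  rewrite -(ler_pM2r n0) -exprSr.
  have <- : rnorm (n * n * n * n) = rnorm n ^+ 4.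
    by rewrite -mulrA rnorm_sa_sqr ?rnorm_sa_sqr -?exprM// adjM sn.
  exact: rnormM.
exists s => //; rewrite rdistC -/n.
suff : rnorm n <= eta / 2 by lra.
rewrite -(@ler_pXn2r _ 3)// ?nnegrE ?rnorm_ge0 ?divr_ge0 ?(ltW eta0)//.
exact: le_trans h4 (le_trans h3 eK).
Qed.

Lemma rnorm_le_of_le a b r : 0 <= r -> nonneg a -> nonneg (b - a) ->
  nonneg (r%:D - b) -> rnorm a <= r.
Proof.
move=> r0 na nab nb; apply: rnorm_le_of_nonneg_sub => //.
by have := nonneg_add nb nab; rewrite addrA subrK.
Qed.

End AdjointSquares.

(** * Conditional expectations and the index *)

Section ConditionalExpectation.
Context {R : realType} {D : cstarAlgType R}.
Variables (A : set D) (E : D -> D).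
Hypotheses (A1 : A 1) (hE : conditional_expectation A E).
Implicit Types (x y a b : D).

Let lE : linear E := cond_exp_linear hE.

Lemma cond_exp_scalar r : E r%:D = r%:D.
Proof. by rewrite linmapZ// (cond_exp_id hE). Qed.

Lemma cond_exp_nonneg a : nonneg a -> nonneg (E a).
Proof.
move=> na; apply: approx_closed_nonneg => e e0.
have [p [pp /nonneg_sa sp _]] := nonneg_sqrt (divr_gt0 e0 (ltr0Sn R 1)) na.
have [|y _ yE] := cond_exp_positive hE (x := p * p).
  by exists p => //; rewrite sp.
exists (E (p * p)); first by rewrite /= -yE; exact: nonneg_adjM.
rewrite -linmapB// pp opprD addrA subrr add0r linmapN// cond_exp_scalar rnormN.
by apply: le_lt_trans (rnorm_scalar _) _; rewrite ger0_norm; lra.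
Qed.

Lemma cond_exp_sa a : adj a = a -> adj (E a) = E a.
Proof.
move=> sa; have := nonneg_sa (cond_exp_nonneg (nonneg_scalar_add sa (lexx _))).
by rewrite linmapD// cond_exp_scalar adjD adj_scalar => /addrI.
Qed.

(** A conditional expectation preserves self-adjointness by positivity; apply
    this to the real and imaginary parts of x. *)
Lemma cond_exp_adj x : E (adj x) = adj (E x).
Proof.
have h : adj (E x) + adj (E (adj x)) = E x + E (adj x).
  by rewrite -adjD -linmapD//; apply: cond_exp_sa; rewrite adjD adjK addrC.
have ci : ('i%C^*)%C = - 'i%C :> R[i] by simpc.
have ii : 'i%C * 'i%C = -1 :> R[i] by rewrite -expr2 sqr_i.
have h' : adj (E x) - adj (E (adj x)) = E (adj x) - E x.
  have : adj (E ('i%C *: (x - adj x))) = E ('i%C *: (x - adj x)).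
    apply: cond_exp_sa; rewrite Defs.adjZ ci adjB adjK scaleNr -scalerN.
    by rewrite opprB.
  rewrite linmapZ// linmapB// Defs.adjZ ci adjB => /(congr1 ( *:%R 'i%C)).
  by rewrite scaleNr scalerN !scalerA ii !scaleN1r opprK opprB.
have /(congr1 ( *:%R (2^-1)%:C)) : 2%:C *: E (adj x) = 2%:C *: adj (E x).
  have -> : 2%:C *: adj (E x) =
      (adj (E x) + adj (E (adj x))) + (adj (E x) - adj (E (adj x))).
    by rewrite (natrD _ 1 1) rmorphD rmorph1; linear_ring.
  by rewrite h h' (natrD _ 1 1) rmorphD rmorph1; linear_ring.
by rewrite !scalerA -!rmorphM mulVf ?pnatr_eq0// rmorph1 !scale1r.
Qed.

(** The Kadison-Schwarz inequality E(x)* E(x) <= E(x* x), obtained by expanding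
    E((x - E x)* (x - E x)) >= 0, followed by E(x* x) <= |x|^2. *)
Lemma cond_exp_contractive x : rnorm (E x) <= rnorm x.
Proof.
rewrite -(@ler_pXn2r _ 2)// ?nnegrE ?rnorm_ge0// -rnorm_adjM.
have AE y : A (E y) by exact: (cond_exp_in hE).
apply: (rnorm_le_of_le (b := E (adj x * x))).
- by rewrite exprn_ge0 ?rnorm_ge0.
- exact: nonneg_adjM.
- have := cond_exp_nonneg (nonneg_adjM (x - E x)).
  rewrite adjB -cond_exp_adj; expand; rewrite !(linmapD lE, linmapN lE).
  rewrite !(cond_exp_Mr hE _ (AE _)) (cond_exp_Ml hE _ (AE _)).
  rewrite (cond_exp_id hE (AE _)).
  by rewrite addNr addr0.
- rewrite -cond_exp_scalar -linmapB//; apply: cond_exp_nonneg.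
  by apply: nonneg_scalar_sub; rewrite ?adjM ?adjK// rnorm_adjM.
Qed.

End ConditionalExpectation.

Section Averaging.
Context {R : realType} {D : cstarAlgType R}.
Variables (C A : set D) (E : D -> D) (N : nat) (a : 'I_N -> D) (U : R).
Hypotheses (C1 : C 1) (hE : conditional_expectation C E).
Hypotheses (hA : cstar_subalgebra A) (CA : C `<=` A) (Aa : forall i, A (a i)).
Hypothesis quasi_basis : forall x, A x -> x = \sum_i a i * E (adj (a i) * x).
Hypotheses (U1 : 1 <= U) (aU : \sum_i rnorm (a i) ^+ 2 <= U).
Implicit Types (x y b : D) (F : D -> D).

Lemma quasi_basis_adj x : A x -> x = \sum_i E (x * a i) * adj (a i).
Proof.
move=> Ax; rewrite -[LHS]adjK [adj x]quasi_basis; last exact: cstar_sub_adj.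
rewrite adj_sum; apply: eq_bigr => i _.
by rewrite adjM -(cond_exp_adj C1 hE) adjM !adjK.
Qed.

(** The element sum_i a_i (x) a_i* of A (x)_C A commutes with A: expand b a_i
    in the quasi-basis, move the coefficients, which lie in C, across the
    tensor sign, and recognise the adjoint expansion of a_j* b. *)
Lemma casimir F b x : linear F -> (forall c y, C c -> F (c * y) = c * F y) ->
  A b ->
  b * (\sum_i a i * F (adj (a i) * x)) = \sum_i a i * F (adj (a i) * (b * x)).
Proof.
move=> lF FC Ab; rewrite mulr_sumr.
have move_left i : b * (a i * F (adj (a i) * x)) =
    \sum_j a j * F (E (adj (a j) * (b * a i)) * (adj (a i) * x)).
  rewrite mulrA [b * a i in LHS]quasi_basis; last exact: cstar_subM.
  rewrite mulr_suml; apply: eq_bigr => j _; rewrite -mulrA -FC//.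
  exact: (cond_exp_in hE).
rewrite (eq_bigr _ (fun i _ => move_left i)).
rewrite exchange_big /=; apply: eq_bigr => j _.
rewrite -mulr_sumr -(linmap_sum lF); congr (_ * F _).
rewrite !mulrA [adj (a j) * b]quasi_basis_adj ?mulr_suml; last first.
  by apply: cstar_subM => //; exact: cstar_sub_adj.
by apply: eq_bigr => i _; rewrite !mulrA.
Qed.

(** Watatani's index of the restriction of E to A. *)
Definition index_element : D := \sum_i a i * adj (a i).

Lemma index_element_comm b : A b -> b * index_element = index_element * b.
Proof.
move=> Ab; have := @casimir id b 1; rewrite !mulr1 => /(_ _ _ Ab).
rewrite {1}/index_element => h.
have -> : \sum_i a i * adj (a i) = \sum_i a i * (adj (a i) * 1).
  by apply: eq_bigr => i _; rewrite mulr1.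
rewrite h//; rewrite /index_element mulr_suml.
by apply: eq_bigr => i _; rewrite mulrA.
Qed.

Lemma index_element_sub : A index_element.
Proof.
rewrite /index_element; elim/big_ind: _ => [|x y|i _].
- exact: cstar_sub0.
- exact: cstar_subD.
- by apply: cstar_subM => //; exact: cstar_sub_adj.
Qed.

Lemma adj_index_element : adj index_element = index_element.
Proof. by rewrite adj_sum; apply: eq_bigr => i _; rewrite adjM adjK. Qed.

Lemma index_element_le : nonneg (U%:D - index_element).
Proof.
apply: nonneg_scalar_sub adj_index_element _.
apply: le_trans (rnorm_sum _) _; apply: le_trans aU; apply: ler_sum => i _.
by rewrite -{1}[a i]adjK rnorm_adjM rnorm_adj.
Qed.

(** Let c_i be the image under E of the adjoint of a_i, so that sum_i a_i c_i =
    1. Writing z_i for U a_i minus the adjoint of c_i, expanding 0 <= sum_i z_i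
    z_i* and bounding sum_i c_i* c_i by U gives U^2 h - 2 U + U >= 0 for the
    index element h. *)
Lemma index_element_ge : nonneg (index_element - U^-1%:D).
Proof.
have U0 : 0 < U := lt_le_trans ltr01 U1.
pose c i := E (adj (a i)).
have ac : \sum_i a i * c i = 1.
  rewrite [RHS]quasi_basis; last exact: CA.
  by apply: eq_bigr => i _; rewrite mulr1.
have ca : \sum_i adj (c i) * adj (a i) = 1.
  by rewrite -adj_one -ac adj_sum; apply: eq_bigr => i _; rewrite adjM.
pose w := \sum_i adj (c i) * c i.
have nw : nonneg (U%:D - w).
  apply: nonneg_scalar_sub.
    by rewrite adj_sum; apply: eq_bigr => i _; rewrite adjM adjK.
  apply: le_trans (rnorm_sum _) _; apply: le_trans aU; apply: ler_sum => i _.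
  rewrite rnorm_adjM -(rnorm_adj (a i)) ler_pXn2r ?nnegrE ?rnorm_ge0//.
  exact: (cond_exp_contractive C1 hE).
have nz i : nonneg ((U%:C *: a i - adj (c i)) * (U%:C *: adj (a i) - c i)).
  have := nonneg_adjM (U%:C *: adj (a i) - c i).
  by rewrite adjB adjZr adjK.
have := nonneg_scale (_ : 0 <= (U ^+ 2)^-1) (nonneg_add (nonneg_sum nz) nw).
rewrite invr_ge0 exprn_ge0 ?(ltW U0)// => /(_ isT).
have -> : \sum_i (U%:C *: a i - adj (c i)) * (U%:C *: adj (a i) - c i) =
    (U ^+ 2)%:C *: index_element - (2 * U)%:D + w.
  have -> : (2 * U)%:D = U%:C *: (\sum_i a i * c i)
      + U%:C *: (\sum_i adj (c i) * adj (a i)).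
    rewrite ac ca /real_scalar -scalerDl -rmorphD; congr (_%:C *: _); ring.
  rewrite /index_element /w !scaler_sumr -big_split -sumrB -big_split /=.
  by apply: eq_bigr => i _; rewrite rmorphXn; expand; linear_ring.
have -> : (U ^+ 2)%:C *: index_element - (2 * U)%:D + w + (U%:D - w) =
    (U ^+ 2)%:C *: (index_element - U^-1%:D).
  rewrite scalerBr /real_scalar scalerA -rmorphM.
  have -> : U ^+ 2 * U^-1 = U by rewrite expr2 mulfK// gt_eqF.
  by rewrite [(2 * U)%:C]rmorphM (natrD _ 1 1) rmorphD rmorph1; linear_ring.
rewrite scalerA -rmorphM mulVf ?rmorph1 ?scale1r//.
by rewrite expf_eq0 /= gt_eqF.
Qed.

(** Both bounds on the index depend on U only, so the Neumann series converges
    at a rate that is uniform in A. *)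
Lemma index_element_inverse : exists k, [/\ index_element * k = 1,
  k * index_element = 1, rnorm k <= U, A k &
  forall b, A b -> b * k = k * b].
Proof.
have U0 : 0 < U := lt_le_trans ltr01 U1; have Ui := mulfV (lt0r_neq0 U0).
have V0 : 0 < U^-1 by rewrite invr_gt0.
set V := U^-1 in Ui V0.
have V1 : V <= 1 by rewrite invf_le1.
pose r := 1 - V ^+ 2.
have r01 : 0 <= r < 1.
  by rewrite /r subr_ge0 expr_le1 ?(ltW V0)// V1 /= gtrBl exprn_gt0.
pose h := V%:C *: index_element.
have hr : rnorm (1 - h) <= r.
  apply: rnorm_le_of_nonneg_sub; first by case/andP: r01.
    have -> : 1 - h = V%:C *: (U%:D - index_element).
      rewrite scalerBr /real_scalar scalerA -rmorphM mulrC Ui rmorph1.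
      by rewrite scale1r.
    by apply: nonneg_scale index_element_le; exact: ltW.
  have -> : r%:D - (1 - h) = V%:C *: (index_element - V%:D).
    rewrite /r /h /real_scalar rmorphB rmorph1 rmorphXn; linear_ring.
  by apply: nonneg_scale index_element_ge; exact: ltW.
have [g [hg gh gr gA]] := element_inverse r01 hr.
have Ah : A h by apply: cstar_subZ => //; exact: index_element_sub.
have Ag : A g.
  apply: gA; [exact: cstar_closed_subspace | exact: CA |].
  by move=> x Ax; exact: cstar_subM.
have e1 : index_element * (V%:C *: g) = 1 by rewrite -hg /h; expand.
have e2 : V%:C *: g * index_element = 1 by rewrite -gh /h; expand.
exists (V%:C *: g); split=> //.
- rewrite rnormZ ger0_norm ?(ltW V0)//.
  apply: le_trans (ler_wpM2l (ltW V0) gr) _.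
  by rewrite /r subKr invfM -/V mulrA mulfV ?gt_eqF// mul1r /V invrK.
- exact: cstar_subZ.
- move=> b Ab; rewrite -[LHS]mul1r -e2 -!mulrA [index_element * _]mulrA.
  by rewrite -index_element_comm// -[b * _ * _]mulrA e1 mulr1.
Qed.

End Averaging.

(** * From a near projection to an intertwiner *)

Section Intertwiner.
Context {R : realType} {D : cstarAlgType R}.
Implicit Types (x y z : D) (F G M W : set D).

(** Successive approximation: each step divides the distance to M by two, and
    the remainder stays in W. *)
Lemma subspace_eq_of_near M W : approx_closed M -> M 0 ->
    (forall x y, M x -> M y -> M (x + y)) ->
    (forall x y, W x -> W y -> W (x - y)) -> M `<=` W ->
    (forall y, W y -> exists2 m, M m & rnorm (y - m) <= 2^-1 * rnorm y) ->
  W `<=` M.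
Proof.
move=> cM M0 MD WB MW near y Wy; apply: cM => e e0.
have approx n : exists2 m, M m & rnorm (y - m) <= rnorm y * 2^-1 ^+ n.
  elim: n => [|n [m Mm mn]]; first by exists 0; rewrite ?subr0 ?expr0 ?mulr1.
  have [|m' Mm' m'n] := near (y - m); first by apply: WB => //; exact: MW.
  exists (m + m'); first exact: MD.
  rewrite opprD addrA exprS mulrCA; apply: le_trans m'n _.
  by rewrite ler_wpM2l// invr_ge0.
have [|n nE] := @geometric_small _ (rnorm y) 2^-1 e _ e0.
  by rewrite invr_ge0 ler0n/= invf_lt1// ltr1n.
by have [m Mm mn] := approx n; exists m => //; apply: le_lt_trans nE.
Qed.

Lemma approx_closed_mul g h M :
  approx_closed M -> approx_closed [set x | M (g * x * h)].
Proof.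
move=> cM x near; apply: cM => e e0.
pose K := rnorm g * rnorm h + 1.
have K0 : 0 < K by rewrite ltr_wpDl ?mulr_ge0 ?rnorm_ge0.
have [y /= My xy] := near _ (divr_gt0 e0 K0); exists (g * y * h) => //.
rewrite -mulrBl -mulrBr; apply: le_lt_trans (rnormM _ _) _.
apply: le_lt_trans (ler_wpM2r (rnorm_ge0 h) (rnormM _ _)) _.
rewrite mulrAC; apply: (@le_lt_trans _ _ (rnorm g * rnorm h * (e / K))).
  by apply: ler_wpM2l; [rewrite mulr_ge0 ?rnorm_ge0 | exact: ltW].
by rewrite mulrCA gtr_pMr// ltr_pdivrMr// mul1r /K ltrDl.
Qed.

Section NearProjection.
Variables (A B : set D) (F T : D -> D) (eta : R).
Hypotheses (hB : cstar_subalgebra B) (B1 : B 1).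
Hypothesis hF : conditional_expectation B F.
Hypotheses (lT : linear T) (eta0 : 0 <= eta) (eta_small : 1000 * eta <= 1).
Hypothesis TA : forall a x, A a -> T (a * x) = a * T x.
Hypothesis TB : forall b x, B b -> T (x * b) = T x * b.
Hypothesis TF : forall x, rnorm (T x - F x) <= eta * rnorm x.

Let cF x : rnorm (F x) <= rnorm x := cond_exp_contractive B1 hF x.

Let rT x : rnorm (T x) <= (1 + eta) * rnorm x.
Proof.
rewrite -[T x](subrK (F x)); apply: le_trans (rnormD _ _) _.
by rewrite addrC mulrDl mul1r lerD.
Qed.

(** The operator 1 - (2 T - 1)^2. *)
Let defect x : D := 4%:C *: (T x - T (T x)).

Let defect_bounded : bounded_by (16 * eta) defect.
Proof.
have bT : bounded_by (1 + eta) T by [].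
have T0 : 0 <= 1 + eta by rewrite addr_ge0.
split; first exact: (bounded_by_scale (ler0n R 4)
  (bounded_by_sub bT (bounded_by_comp T0 bT bT))).1.
move=> x; rewrite /defect rnormZ ger0_norm//.
have -> : T x - T (T x) = (T x - F x) - ((T (T x) - F (T x)) + F (T x - F x)).
  rewrite (linmapB (cond_exp_linear hF)).
  by rewrite [F (F x)](cond_exp_id hF (cond_exp_in hF x)); linear_ring.
have h1 := rnormB (T x - F x) ((T (T x) - F (T x)) + F (T x - F x)).
have h2 := rnormD (T (T x) - F (T x)) (F (T x - F x)).
have h3 := cF (T x - F x); have h4 := TF x; have h5 := TF (T x).
have h6 := ler_wpM2l eta0 (rT x); have x0 := rnorm_ge0 x.
have h7 : eta * ((1 + eta) * rnorm x) <= 2 * eta * rnorm x.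
  rewrite mulrA ler_wpM2r// [2 * eta]mulrC ler_wpM2l//.
  by have := eta0; have := eta_small; lra.
lra.
Qed.

(** The operator T is close to the idempotent F, so 2 T - 1 has a square close
    to 1, with square root S = 1 - Y. The subspace W on which 2 T - 1 = S plays
    the role of the range of the idempotent near T; it is a left A-module and a
    right B-module, because T is a map of such bimodules. It contains v = (2 T
    - 1 + S)(1) / 2, which is close to 1, and y is close to v F(y) for y in W.
    Hence W = v B, and a v, which belongs to W, has the form v b. *)
Lemma near_projection_intertwiner : exists v, [/\ rnorm (1 - v) <= 9 * eta,
  forall a, A a -> exists2 b, B b & a * v = v * b &
  forall G, closed_subspace G -> G 1 -> (forall x, G x -> G (T x)) -> G v].
Proof.
have r01 : 0 <= 16 * eta < 1.
  by apply/andP; split; move: eta0 eta_small; lra.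
have [Y [bY YE YG YC]] := operator_sqrt r01 defect_bounded.
have lY := bY.1.
have YA a x : A a -> Y (a * x) = a * Y x.
  move=> Aa; symmetry; apply: (YC _ ( *%R a) (rnorm_ge0 a)) => [|{}x].
    exact: bounded_by_mull.
  by rewrite /defect !TA// -mulrBr cstar_scalerAr.
have YB b x : B b -> Y (x * b) = Y x * b.
  move=> Bb; symmetry; apply: (YC _ ( *%R^~ b) (rnorm_ge0 b)) => [|{}x].
    exact: bounded_by_mulr.
  by rewrite /defect !TB// -mulrBl cstar_scalerAl.
have YT x : T (Y x) = Y (T x).
  apply: (YC (1 + eta)) => [||{}x]; first by rewrite addr_ge0.
    by split.
  by rewrite /defect linmapZ// linmapB.
pose W := [set y | T y + T y - y = y - Y y].
pose w := T 1 + T 1 - Y 1; pose v := (2^-1)%:C *: w.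
have YE1 : Y 1 + Y 1 = (T 1 - T (T 1)) *+ 4 + Y (Y 1).
  by rewrite YE /defect rmorph_nat scaler_nat.
have Wv : W v.
  rewrite /W /= /v (linmapZ lT) (linmapZ lY) -!scalerDr -!scalerBr.
  congr (_ *: _).
  rewrite /w !(linmapB lT, linmapB lY, linmapD lT, linmapD lY) YT.
  apply/eqP; rewrite -subr_eq0; apply/eqP.
  have -> : Y (Y 1) = Y 1 + Y 1 - (T 1 - T (T 1)) *+ 4.
    by rewrite YE1; linear_ring.
  by linear_ring.
have nat2 x : x *+ 2 = 2%:C *: x by rewrite rmorph_nat scaler_nat.
have v1 : rnorm (1 - v) <= 9 * eta.
  have -> : 1 - v = (2^-1)%:C *: (Y 1 - (T 1 - F 1) *+ 2).
    have -> : 1 - v = (2^-1)%:C *: ((1 : D) *+ 2 - w).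
      rewrite scalerBr nat2 scalerA -rmorphM mulVf ?pnatr_eq0//.
      by rewrite rmorph1 scale1r.
    by congr (_ *: _); rewrite /w (cond_exp_id hF B1); linear_ring.
  rewrite rnormZ ger0_norm ?invr_ge0//.
  have h1 := rnormB (Y 1) ((T 1 - F 1) *+ 2).
  have h2 := rnormD (T 1 - F 1) (T 1 - F 1); rewrite -mulr2n in h2.
  have h3 := bY.2 1; have h4 := TF 1.
  have h5 := ler_wpM2l eta0 (@rnorm1_le R D); lra.
have q01 : 0 <= 9 * eta < 1.
  by apply/andP; split; move: eta0 eta_small; lra.
have [g [vg gv _ _]] := element_inverse q01 v1.
(* M is v B, described as a preimage so that it is visibly closed. *)
pose M := [set x | B (g * x * 1)].
exists v; split=> // [a Aa|G cG G1 GT]; last first.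
  have GY x : G x -> G (Y x).
    apply: (YG G cG) => y Gy; rewrite /defect; apply: (closed_subspaceZ cG).
    by apply: (closed_subspaceB cG); [exact: GT | exact: GT (GT _ Gy)].
  apply: (closed_subspaceZ cG); apply: (closed_subspaceB cG); last exact: GY.
  by apply: (closed_subspaceD cG); exact: GT.
suff MWe : W `<=` M.
  have : M (a * v).
    apply: MWe; rewrite /W /= TA// YA//.
    have := Wv; rewrite /W /= => Wv'.
    by rewrite -mulrDr -mulrBr Wv' mulrBr.
  rewrite /M /= mulr1 => Bm; exists (g * (a * v)) => //.
  by rewrite mulrA vg mul1r.
have WB b y : B b -> W y -> W (y * b).
  move=> Bb; rewrite /W /= => Wy.
  by rewrite TB// YB// -mulrDl -mulrBl Wy mulrBl.
have BM := cstar_closed_subspace hB.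
apply: subspace_eq_of_near.
- exact: approx_closed_mul (closed_subspace_lim BM).
- by rewrite /M /= mulr0 mul0r; exact: cstar_sub0.
- by move=> x y; rewrite /M /= !mulr1 mulrDr; exact: cstar_subD.
- move=> x y; rewrite /W /= => Wx Wy; rewrite (linmapB lT) (linmapB lY).
  have -> : T x - T y + (T x - T y) - (x - y) =
      (T x + T x - x) - (T y + T y - y).
    by linear_ring.
  by rewrite Wx Wy; linear_ring.
- move=> x; rewrite /M /= mulr1 => Bx.
  by rewrite -[x]mul1r -vg -mulrA; exact: WB.
move=> y; rewrite /W /= => Wy; exists (v * F y).
  by rewrite /M /= mulr1 mulrA gv mul1r; exact: (cond_exp_in hF).
have h1 : (y - T y) *+ 2 = Y y.
  have -> : (y - T y) *+ 2 = y - (T y + T y - y) by linear_ring.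
  by rewrite Wy subKr.
have h2 : 2 * rnorm (y - T y) <= 16 * eta * rnorm y.
  have <- : rnorm ((y - T y) *+ 2) = 2 * rnorm (y - T y).
    by rewrite nat2 rnormZ ger0_norm.
  by rewrite h1; exact: bY.2.
have h3 : rnorm (y - v * F y) <=
    rnorm (y - T y) + rnorm (T y - F y) + rnorm ((1 - v) * F y).
  have -> : y - v * F y = (y - T y) + (T y - F y) + (1 - v) * F y.
    by expand; linear_ring.
  by apply: le_trans (rnormD _ _) _; rewrite lerD2r rnormD.
have h4 := TF y; have h5 := rnormM_le v1 (cF y); have y0 := rnorm_ge0 y.
have h6 := ler_wpM2r y0 eta_small.
lra.
Qed.

End NearProjection.
End Intertwiner.

(** * From an intertwiner to a unitary *)

Section PolarDecomposition.
Context {R : realType} {D : cstarAlgType R}.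
Implicit Types (x y z : D) (A B G : set D).

(** Let p = v* v and u* = v p^(-1/2). Since v B = A v and, taking adjoints, B
    v* = v* A, conjugation by p maps B onto itself. It is close to the
    identity, so it has a square root which also leaves B invariant.
    Conjugation by p^(1/2) is another square root close to the identity; the
    two commute, hence coincide. So conjugation by p^(1/2) preserves B, and u
    conjugates A to B as v^(-1) does. *)
Lemma unitary_of_similarity A B v g :
    cstar_subalgebra A -> cstar_subalgebra B ->
    v * g = 1 -> g * v = 1 -> 100 * rnorm (1 - v) <= 1 ->
    (forall a, A a -> B (g * a * v)) -> (forall b, B b -> A (v * b * g)) ->
  exists u, [/\ unitary u, [set u * a * adj u | a in A] = B &
    forall G, cstar_subalgebra G -> G 1 -> G v -> G u].
Proof.
move=> hA hB vg gv v1 AB BA.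
pose t : R := 100^-1; have t100 : 100 * t = 1 by rewrite /t mulfV.
have v1' : rnorm (1 - v) <= t by move: v1; lra.
have av1 : rnorm (1 - adj v) <= t by rewrite -[1 : D]adj_one -adjB rnorm_adj.
have vn : rnorm v <= 1 + t.
  rewrite -[v](subKr 1); apply: le_trans (rnormB _ _) _.
  by apply: lerD => //; exact: rnorm1_le.
have gn : rnorm g <= 2.
  have gE : 1 + (1 - v) * g = g by rewrite mulrBl vg; expand; linear_ring.
  have h := rnormM_le v1' (lexx (rnorm g)).
  have := rnormD 1 ((1 - v) * g); rewrite gE.
  have t2 : t <= 2^-1 by lra.
  have := @rnorm1_le R D; have := ler_wpM2r (rnorm_ge0 g) t2; lra.
have [p pE] : exists p, p = adj v * v by exists (adj v * v).
have [q qE] : exists q, q = g * adj g by exists (g * adj g).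
have gv' : adj v * adj g = 1 by rewrite -adjM gv adj_one.
have vg' : adj g * adj v = 1 by rewrite -adjM vg adj_one.
have pq : p * q = 1 by rewrite pE qE -mulrA [v * _]mulrA vg mul1r.
have qp : q * p = 1 by rewrite pE qE -mulrA [adj g * _]mulrA vg' mul1r.
have sp : adj p = p by rewrite pE adjM adjK.
have p1 : rnorm (1 - p) <= 3 * t.
  have -> : 1 - p = (1 - adj v) * v + (1 - v).
    by rewrite pE; expand; linear_ring.
  apply: le_trans (rnormD _ _) _; have := rnormM_le av1 vn; nra.
have qn : rnorm q <= 4.
  have := rnormM_le gn (_ : rnorm (adj g) <= 2); rewrite rnorm_adj => /(_ gn).
  by rewrite -qE; lra.
have r01 : 0 <= 3 * t < 1 by apply/andP; split; lra.
have [s [ss sas s1 sG scomm]] := element_sqrt_sa r01 p1 sp.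
have [s' [ss' s's s'n s'G]] := element_inverse r01 s1.
have s'n2 : rnorm s' <= 2.
  apply: le_trans s'n _; rewrite -[2]invrK lef_pV2 ?posrE ?invr_gt0//; lra.
have sas' : adj s' = s'.
  have h : adj s' * s = 1 by rewrite -[s]sas -adjM ss' adj_one.
  by rewrite -[LHS]mulr1 -ss' mulrA h mul1r.
have s's' : s' * s' = q.
  rewrite -[LHS]mulr1 -pq -ss !mulrA -[s' * s' * s]mulrA s's mulr1.
  by rewrite s's mul1r.
have sq : s * q = s' by rewrite -s's' mulrA ss' mul1r.
have ps' : p * s' = s by rewrite -ss -mulrA ss' mulr1.
have s'p : s' * p = s by rewrite -ss mulrA s's mul1r.
have pB z : B z -> B (p * z * q).
  move=> Bz; have -> : p * z * q = adj (g * adj (v * z * g) * v).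
    by rewrite pE qE !adjM !adjK !mulrA.
  apply: cstar_sub_adj => //; apply: AB.
  by apply: cstar_sub_adj => //; exact: BA.
have qB z : B z -> B (q * z * p).
  move=> Bz; have -> : q * z * p = g * adj (v * adj z * g) * v.
    by rewrite pE qE !adjM !adjK !mulrA.
  apply: AB; apply: cstar_sub_adj => //; apply: BA; exact: cstar_sub_adj.
have sB z : B z -> B (s * z * s').
  (* 1 - Y is the square root of conjugation by p that preserves B, and S' is
     conjugation by s; w is their difference at z. *)
  pose X z := z - p * z * q.
  have bX : bounded_by (24 * t) X.
    split=> [c x y|x]; first by rewrite /X; expand; linear_ring.
    have -> : X x = ((1 - p) * x - x * (1 - p)) * q.
      rewrite mulrBl mulrBr; expand.
      by rewrite -[x * p * q]mulrA pq mulr1 /X; linear_ring.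
    have h1 := rnormM_le p1 (lexx (rnorm x)).
    have h2 := rnormM_le (lexx (rnorm x)) p1.
    have h3 := rnormM_le (le_trans (rnormB _ _) (lerD h1 h2)) qn.
    by apply: le_trans h3 _; lra.
  have r24 : 0 <= 24 * t < 1 by apply/andP; split; lra.
  have [Y [bY YE YB YC]] := operator_sqrt r24 bX.
  pose S' z := s * z * s'.
  have bS' : bounded_by (rnorm s' * rnorm s) S'.
    exact: (bounded_by_comp (rnorm_ge0 s') (bounded_by_mulr s')
      (bounded_by_mull s)).
  have S'Y x : S' (Y x) = Y (S' x).
    apply: (YC _ _ _ bS') => [|{}x]; first by rewrite mulr_ge0 ?rnorm_ge0.
    rewrite /S' /X mulrBr mulrBl; congr (_ - _).
    by rewrite -s's' -ss !mulrA.
  have S'E x : ((1 - s) * x - x * (1 - s)) * s' = x - S' x.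
    by expand; rewrite -[x * s * s']mulrA ss' mulr1 /S'; linear_ring.
  pose w := (z - Y z) - S' z.
  have w0 : w - Y w + S' w = 0.
    have -> : w - Y w + S' w = z - (Y z + Y z) + Y (Y z) - S' (S' z).
      rewrite /w !(linmapB bY.1, linmapB bS'.1) S'Y; linear_ring.
    rewrite YE /X /S' !mulrA ss -[p * z * s' * s']mulrA s's'; linear_ring.
  (* Both square roots are close to 1, so their sum is close to 2 and cannot
     kill w unless w = 0. *)
  have w2 : w *+ 2 = Y w + ((1 - s) * w - w * (1 - s)) * s'.
    rewrite S'E -[LHS]subr0 -w0; linear_ring.
  have -> : s * z * s' = z - Y z.
    suff w_eq0 : rnorm w = 0 by move/rnorm_eq0/subr0_eq: w_eq0 => ->.
    have h1 := rnormM_le s1 (lexx (rnorm w)).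
    have h2 := rnormM_le (lexx (rnorm w)) s1.
    have h3 := rnormM_le (le_trans (rnormB _ _) (lerD h1 h2)) s'n2.
    have h4 := rnormD (Y w) (((1 - s) * w - w * (1 - s)) * s').
    have h5 := bY.2 w.
    have h6 : rnorm (w *+ 2) = 2 * rnorm w.
      by rewrite -scaler_nat -(rmorph_nat (real_complex R)) rnormZ ger0_norm.
    rewrite -w2 h6 in h4; have w_ge0 := rnorm_ge0 w.
    have h7 : 100 * (t * rnorm w) = rnorm w by rewrite mulrA t100 mul1r.
    lra.
  move=> Bz; have cB := cstar_closed_subspace hB.
  apply: (closed_subspaceB cB) => //.
  apply: (YB B cB) Bz => x Bx; rewrite /X.
  by apply: (closed_subspaceB cB) => //; exact: pB.
have [u uE] : exists u, u = s' * adj v by exists (s' * adj v).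
have au : adj u = v * s' by rewrite uE adjM adjK sas'.
have uu : adj u * u = 1.
  by rewrite au uE mulrA -[v * s' * s']mulrA s's' qE mulrA vg mul1r vg'.
have uu' : u * adj u = 1.
  by rewrite au uE mulrA -[s' * adj v * v]mulrA -pE s'p ss'.
exists u; split=> //.
- apply/seteqP; split=> [_ [a Aa <-]|z Bz].
    have -> : u * a * adj u = s * (g * a * v) * s'.
      by rewrite au uE -s'p pE !mulrA -[s' * adj v * v * g]mulrA vg mulr1.
    by apply: sB; exact: AB.
  exists (adj u * z * u); last by rewrite !mulrA uu' mul1r -mulrA uu' mulr1.
  have -> : adj u * z * u = v * (s * (q * z * p) * s') * g.
    rewrite au uE; have -> : adj v = p * g by rewrite pE -mulrA vg mulr1.
    by rewrite !mulrA -[v * s * q]mulrA sq; congr (_ * _);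
      rewrite -[_ * s' * p]mulrA s'p -[_ * p * s']mulrA ps'.
  by apply: BA; apply: sB; exact: qB.
move=> G hG G1 Gv; have cG := cstar_closed_subspace hG.
have Gav : G (adj v) by exact: cstar_sub_adj.
have Gp : G p by rewrite pE; exact: cstar_subM.
have Gs : G s by apply: sG => // x Gx; exact: cstar_subM.
have Gs' : G s' by apply: s'G => // x Gx; exact: cstar_subM.
by rewrite uE; exact: cstar_subM.
Qed.

End PolarDecomposition.

(** * Intermediate subalgebras *)

Section Subalgebras.
Context {R : realType} {D : cstarAlgType R}.
Implicit Types (x y : D) (A B C G : set D).

Lemma near_of_excess A B (gamma : R) :
  cstar_subalgebra A -> cstar_subalgebra B ->
  (excess A B < gamma%:E)%E ->
  forall a, A a -> exists2 b, B b & rnorm (a - b) <= gamma * rnorm a.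
Proof.
move=> hA hB AB a Aa; have [a0|an] := eqVneq (rnorm a) 0.
  by exists 0; [exact: cstar_sub0 | rewrite subr0 a0 mulr0].
have ap : 0 < rnorm a by rewrite lt_def an rnorm_ge0.
pose c : D := (rnorm a)^-1%:C *: a.
have c1 : unit_ball A c.
  split; first exact: cstar_subZ.
  rewrite normr_rnorm rnormZ ger0_norm ?invr_ge0 ?rnorm_ge0//.
  by rewrite mulVf// rmorph1.
have : (ereal_inf [set (rnorm (c - b))%:E | b in unit_ball B] < gamma%:E)%E.
  by apply: le_lt_trans AB; apply: ereal_sup_ubound; exists c.
move=> /ereal_inf_lt[_ [b [Bb _] <-]]; rewrite lte_fin => cb.
exists ((rnorm a)%:C *: b); first exact: cstar_subZ.
have -> : a - (rnorm a)%:C *: b = (rnorm a)%:C *: (c - b).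
  by rewrite scalerBr scalerA -rmorphM mulfV// rmorph1 scale1r.
by rewrite rnormZ ger0_norm ?rnorm_ge0// mulrC ler_wpM2r ?rnorm_ge0// ltW.
Qed.

Lemma cstar_subalgebra_generated A B : cstar_subalgebra (cstar_generated A B).
Proof.
split.
- by move=> M [hM _]; exact: cstar_sub0.
- move=> x y Gx Gy M hM.
  by apply: cstar_subD hM.1 _ _ _ _; [exact: Gx | exact: Gy].
- by move=> c x Gx M hM; apply: cstar_subZ hM.1 _ _ _; exact: Gx.
- move=> x y Gx Gy M hM.
  by apply: cstar_subM hM.1 _ _ _ _; [exact: Gx | exact: Gy].
- by move=> x Gx M hM; apply: cstar_sub_adj hM.1 _ _; exact: Gx.
- apply/closed_approx => x near M hM.
  apply: (proj1 (closed_approx M) (cstar_sub_closed hM.1)) => e /near[y Gy xy].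
  by exists y => //; exact: Gy.
Qed.

Lemma cstar_subalgebra_commutant C : cstar_subalgebra C ->
  cstar_subalgebra (relative_commutant C).
Proof.
move=> hC; split.
- by move=> c _; rewrite mulr0 mul0r.
- by move=> x y xC yC c Cc; rewrite mulrDl mulrDr xC// yC.
- by move=> k x xC c Cc; rewrite -cstar_scalerAl -cstar_scalerAr xC.
- by move=> x y xC yC c Cc; rewrite -mulrA yC// mulrA xC// mulrA.
- move=> x xC c Cc; rewrite -[c]adjK -!adjM xC//; exact: cstar_sub_adj.
- apply/closed_approx => x near c Cc; apply: approx_closed_comm => e.
  move=> /near[y yC xy].
  by exists y => //; exact: yC.
Qed.

Lemma cstar_subalgebraI A B : cstar_subalgebra A -> cstar_subalgebra B ->
  cstar_subalgebra (A `&` B).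
Proof.
case=> A0 AD AZ AM Aa cA [B0 BD BZ BM Ba cB]; split=> //.
- by move=> x y [? ?] [? ?]; split; [exact: AD | exact: BD].
- by move=> k x [? ?]; split; [exact: AZ | exact: BZ].
- by move=> x y [? ?] [? ?]; split; [exact: AM | exact: BM].
- by move=> x [? ?]; split; [exact: Aa | exact: Ba].
- exact: closedI.
Qed.

(** Apply EA to the expansion of x in the quasi-basis of E; compatibility of
    the expectations lets EA into the coefficients. *)
Lemma expectation_quasi_basis C A (E EA : D -> D) (N : nat) (u : 'I_N -> D) :
    C 1 -> C `<=` A -> conditional_expectation C E ->
    conditional_expectation A EA ->
    (forall x, E (EA x) = E x) ->
    (forall x, x = \sum_(i < N) u i * E (adj (u i) * x)) ->
  forall x, A x -> x = \sum_(i < N) EA (u i) * E (adj (EA (u i)) * x).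
Proof.
move=> C1 CA hE hEA EEA uE x Ax; have A1 : A 1 by exact: CA.
rewrite -{1}(cond_exp_id hEA Ax) [in LHS](uE x).
rewrite (linmap_sum (cond_exp_linear hEA)).
apply: eq_bigr => i _; rewrite (cond_exp_Mr hEA); last first.
  by apply: CA; exact: (cond_exp_in hE).
by rewrite -(cond_exp_adj A1 hEA) -(cond_exp_Mr hEA _ Ax) EEA.
Qed.

End Subalgebras.

Section AveragedExpectation.
Context {R : realType} {D : cstarAlgType R}.
Variables (C A B : set D) (F : D -> D) (N : nat) (a : 'I_N -> D) (k : D).
Variables (U delta : R).
Hypotheses (hA : cstar_subalgebra A) (hB : cstar_subalgebra B) (B1 : B 1).
Hypotheses (hF : conditional_expectation B F) (Aa : forall i, A (a i)).
Hypotheses (kn : rnorm k <= U) (aU : \sum_i rnorm (a i) ^+ 2 <= U).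
Hypothesis delta0 : 0 <= delta.
Hypothesis near : forall x, A x ->
  exists2 b, B b & rnorm (x - b) <= delta * rnorm x.

(** The average over A of F, conjugated by the quasi-basis: k is the inverse of
    the index element, so that the weights a_i (x) k a_i* have product 1. *)
Definition averaged x : D := k * \sum_i a i * F (adj (a i) * x).

Lemma averaged_linear : linear averaged.
Proof.
move=> c x y; rewrite /averaged cstar_scalerAr -mulrDr; congr (_ * _).
rewrite scaler_sumr -big_split; apply: eq_bigr => i _ /=.
by rewrite mulrDr -cstar_scalerAr (cond_exp_linear hF) mulrDr cstar_scalerAr.
Qed.

Lemma averagedMr b x : B b -> averaged (x * b) = averaged x * b.
Proof.
move=> Bb; rewrite /averaged -mulrA mulr_suml; congr (_ * _).
by apply: eq_bigr => i _; rewrite mulrA (cond_exp_Mr hF)// mulrA.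
Qed.

(** If B contained A, the coefficients a_i* could be pulled out of F, and the
    average would be F itself; replacing each a_i* by a nearby element of B
    costs two errors. *)
Lemma averaged_near x : k * (\sum_i a i * adj (a i)) = 1 ->
  rnorm (averaged x - F x) <= 2 * delta * U ^+ 2 * rnorm x.
Proof.
move=> kh; have U0 := le_trans (rnorm_ge0 k) kn.
have step i : rnorm (a i * F (adj (a i) * x) - a i * adj (a i) * F x) <=
    rnorm (a i) ^+ 2 * (2 * delta * rnorm x).
  have [b Bb ab] := near (cstar_sub_adj hA (Aa i)).
  have -> : a i * F (adj (a i) * x) - a i * adj (a i) * F x =
      a i * (F ((adj (a i) - b) * x) - (adj (a i) - b) * F x).
    rewrite [in RHS]mulrBl (linmapB (cond_exp_linear hF)) (cond_exp_Ml hF _ Bb).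
    by expand; linear_ring.
  rewrite rnorm_adj in ab; have Fx := cond_exp_contractive B1 hF x.
  have h1 := le_trans (cond_exp_contractive B1 hF _)
    (rnormM_le ab (lexx (rnorm x))).
  have h2 := rnormM_le ab Fx.
  have h3 := rnormM_le (lexx (rnorm (a i)))
    (le_trans (rnormB _ _) (lerD h1 h2)).
  by apply: le_trans h3 _; rewrite le_eqVlt; apply/orP; left; apply/eqP; ring.
have -> : averaged x - F x =
    k * \sum_i (a i * F (adj (a i) * x) - a i * adj (a i) * F x).
  by rewrite sumrB mulrBr -mulr_suml mulrA kh mul1r.
apply: le_trans (rnormM _ _) _.
have -> : 2 * delta * U ^+ 2 * rnorm x = U * (U * (2 * delta * rnorm x)).
  by ring.
apply: ler_pM; rewrite ?rnorm_ge0//.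
apply: le_trans (rnorm_sum _) (le_trans (ler_sum _ (fun i _ => step i)) _).
by rewrite -mulr_suml ler_wpM2r// !mulr_ge0 ?rnorm_ge0.
Qed.

End AveragedExpectation.

Theorem proposition3p5 (R : realType) (D : cstarAlgType R) (C : set D)
    (E : D -> D)
    (hC : cstar_subalgebra C) (hC1 : C 1)
    (hE : conditional_expectation C E) (hfin : finite_index E) :
  exists2 gamma : R, 0 < gamma &
    forall A B : set D, IMS C E A -> IMS C E B ->
      (cstar_dist A B < gamma%:E)%E ->
      exists u : D, [/\ cstar_generated A B u, unitary u,
        [set u * a * adj u | a in A] = B & relative_commutant C u].
Proof.
have [N [u0 u0E]] := hfin.
pose U : R := 1 + \sum_i rnorm (u0 i) ^+ 2.
have U1 : 1 <= U.
  by rewrite lerDl sumr_ge0// => i _; rewrite exprn_ge0 ?rnorm_ge0.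
have U0 : 0 < U := lt_le_trans ltr01 U1.
(* With eta = 2 gamma U^2, the distance from the average to EB, this is
   eta = 1/1000. *)
have [gamma gamma0 etaE] :
    exists2 gamma : R, 0 < gamma & 1000 * (2 * gamma * U ^+ 2) = 1.
  have [M ME] : exists M : R, M = 1000 * 2 * U ^+ 2 by eexists.
  have M0 : 0 < M by rewrite ME !mulr_gt0 ?ltr0n ?exprn_gt0.
  exists M^-1; first by rewrite invr_gt0.
  have MV : M^-1 * M = 1 by rewrite mulVf ?lt0r_neq0.
  by rewrite -[RHS]MV {3}ME; ring.
exists gamma => // A B [hA CA [EA hEA EEA]] [hB CB [EB hEB EEB]].
rewrite /cstar_dist gt_max => /andP[/(near_of_excess hA hB) nearAB].
move=> /(near_of_excess hB hA) nearBA.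
have A1 : A 1 by exact: CA.
have B1 : B 1 by exact: CB.
pose a i := EA (u0 i); have Aa i : A (a i) by exact: (cond_exp_in hEA).
have qb := expectation_quasi_basis hC1 CA hE hEA EEA u0E.
have aU : \sum_i rnorm (a i) ^+ 2 <= U.
  apply: (@le_trans _ _ (\sum_i rnorm (u0 i) ^+ 2)); last by rewrite lerDr.
  apply: ler_sum => i _; rewrite ler_pXn2r ?nnegrE ?rnorm_ge0//.
  exact: (cond_exp_contractive A1 hEA).
have [k [_ kh kU Ak kA]] := index_element_inverse hC1 hE hA CA Aa qb U1 aU.
pose T := averaged EB a k; pose eta := 2 * gamma * U ^+ 2.
have TA b x : A b -> T (b * x) = b * T x.
  move=> Ab; rewrite /T /averaged mulrA kA// -mulrA; congr (_ * _); symmetry.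
  apply: (casimir hC1 hE hA Aa qb) => //; first exact: (cond_exp_linear hEB).
  by move=> c y Cc; apply: (cond_exp_Ml hEB); exact: CB.
have TB b x : B b -> T (x * b) = T x * b by exact: (averagedMr a k hEB).
have TF x : rnorm (T x - EB x) <= eta * rnorm x.
  exact: (averaged_near hA B1 hEB Aa kU aU (ltW gamma0) nearAB x kh).
have lT : linear T by exact: (averaged_linear a k hEB).
have eta0 : 0 <= eta by rewrite !mulr_ge0 ?exprn_ge0 ?(ltW U0) ?(ltW gamma0).
have eta1 : 1000 * eta <= 1 by rewrite /eta etaE lexx.
have [v [v1 vAB vG]] :=
  near_projection_intertwiner hB B1 hEB lT eta0 eta1 TA TB TF.
have r01 : 0 <= 9 * eta < 1 by apply/andP; split; lra.
have [g [vg gv gn _]] := element_inverse r01 v1.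
have gAB b : A b -> B (g * b * v).
  by move=> /vAB[c Bc bv]; rewrite -mulrA bv mulrA gv mul1r.
have g2 : rnorm g <= 2.
  apply: le_trans gn _; rewrite -[2]invrK lef_pV2 ?posrE ?invr_gt0//; lra.
have gamma_eta : gamma <= eta.
  by rewrite /eta mulrAC ler_peMl ?(ltW gamma0)//; nra.
(* The inclusion v^-1 A v in B is an equality: each y in B has an element c of A
   nearby, and v^-1 c v is still close to y. *)
have vBA b : B b -> A (v * b * g).
  pose M := [set x | A (v * x * g)].
  have cM : approx_closed M.
    exact: approx_closed_mul (closed_subspace_lim (cstar_closed_subspace hA)).
  have cB := cstar_closed_subspace hB.
  suff BM : B `<=` M by move=> /BM.
  apply: (subspace_eq_of_near cM) => [|x y|x y||y By].
  - by rewrite /M /= mulr0 mul0r; exact: cstar_sub0.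
  - by rewrite /M /= mulrDr mulrDl; exact: cstar_subD.
  - exact: closed_subspaceB.
  - move=> x /gAB; rewrite /M /= !mulrA gv mul1r.
    by rewrite -!mulrA gv mulr1.
  have [c Ac yc] := nearBA y By; exists (g * c * v).
    by rewrite /M /= !mulrA vg mul1r -!mulrA vg mulr1.
  have -> : y - g * c * v = g * ((y - c) * v + (y * (1 - v) - (1 - v) * y)).
    by expand; rewrite gv; expand; linear_ring.
  have vn : rnorm v <= 2.
    rewrite -[v](subKr 1); apply: le_trans (rnormB _ _) _.
    by have := @rnorm1_le R D; lra.
  have h1 := rnormM_le yc vn.
  have h2 := rnormM_le v1 (lexx (rnorm y)).
  have h3 := rnormM_le (lexx (rnorm y)) v1.
  have h4 := le_trans (rnormD _ _)
    (lerD h1 (le_trans (rnormB _ _) (lerD h3 h2))).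
  have h5 := rnormM_le g2 h4.
  apply: le_trans h5 _; have y0 := rnorm_ge0 y.
  have h6 := ler_wpM2r y0 gamma_eta; have h7 := ler_wpM2r y0 eta1; lra.
have v100 : 100 * rnorm (1 - v) <= 1 by lra.
have [u [uu uAB uG]] := unitary_of_similarity hA hB vg gv v100 gAB vBA.
(* The unitary is obtained from v by operations available in any C*-subalgebra,
   so one may work inside this one from the start. *)
pose G := cstar_generated A B `&` relative_commutant C.
have hgen := cstar_subalgebra_generated A B.
have hG : cstar_subalgebra G.
  by apply: cstar_subalgebraI => //; exact: cstar_subalgebra_commutant.
have AG x : A x -> cstar_generated A B x by move=> Ax M [_]; apply; left.
have BG x : B x -> cstar_generated A B x by move=> Bx M [_]; apply; right.
have G1 : G 1 by split; [exact: AG | move=> c _; rewrite mul1r mulr1].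
have GT x : G x -> G (T x).
  move=> [Gx Cx]; split.
    rewrite /T /averaged; apply: (cstar_subM hgen); first exact: AG.
    elim/big_ind: _ => [|y z|i _].
    - exact: (cstar_sub0 hgen).
    - exact: (cstar_subD hgen).
    - apply: (cstar_subM hgen); first exact: AG.
      by apply: BG; exact: (cond_exp_in hEB).
  by move=> c Cc; rewrite -TB ?Cx ?TA//; [exact: CA | exact: CB].
have Gv : G v by apply: vG => //; exact: cstar_closed_subspace.
by have [Gu Cu] := uG G hG G1 Gv; exists u.
Qed.
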